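(* Let $X$ be a standard process on $(0,\infty)$ with no negative jumps satisfying (A1)--(A3), $\lim_{b \to \infty}\lim_{x \to \infty}\mathbb{P}_{x}[\tau_{b}^{-} \leq t] = 1$ for every $t>0$, $\zeta=\tau_0$, $\mathbb P_x[\tau_0<\infty]>0$ for every $x>0$, and $\mathbb P_x[\tau_y<\infty]>0$ for all $x,y\in(0,\infty)$, regarded as a Feller process on $I=(0,\infty]$. Assume (SF): for every $f \in \mathcal{B}_{b}(I)$ and $t > 0$, the function $(0,\infty) \ni x \mapsto p_{t}f(x)$ is bounded and continuous. Let $\lambda_{1} := -\sup\{ \operatorname{Re} q \mid q \in \mathcal{N} \setminus \{-\lambda_{0} \} \}$ with $\mathcal N:=\{q\in\mathbb C\mid Z^{(q)}(0)=0\}$, let $\delta \in (0,\lambda_{1} - \lambda_{0})$, and let $M_{\delta} \in (0,\infty)$ be a constant such that $$\sup_{f \in \mathcal{B}_{b}(I),\, \|f\|_{\infty} \leq 1}\| e^{\lambda_{0}t} p_{t}f - \pi_{\lambda_{0}}f \|_{\infty} \leq M_{\delta}e^{-\delta t} \quad (t > 0).$$ Then for every $x \in (0,\infty]$ and $t>0$, $$\sup_{\substack{f:(0,\infty]\to \mathbb{R}\text{ measurable}, \\ \|fZ^{(-\lambda_{0})}\|_{\infty} \leq 1}} |q_{t}f(x) - \mu(f) | \leq \frac{M_{\delta}}{Z^{(-\lambda_{0})}(x)}e^{-\delta t},$$ where $$q_{t}f(x) := \frac{e^{\lambda_{0}t}}{Z^{(-\lambda_{0})}(x)}\,p_{t}(Z^{(-\lambda_{0})}f)(x),\qquad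 \mu(du) := \frac{1}{\rho}W^{(-\lambda_{0})}(0,u)Z^{(-\lambda_{0})}(u)\,m(du).$$
   Context: $X=(\Omega,\mathcal F,\mathcal F_t,X_t,\theta_t,\mathbb P_x)$ is a standard process in the sense of Blumenthal--Getoor (normal, right-continuous, strong Markov, with left limits and quasi-left-continuity on $[0,\zeta)$) on $(0,\infty)$ with cemetery $\partial$ and lifetime $\zeta$; measurable functions are extended by $f(\partial)=0$. $\tau_A:=\inf\{t>0\mid X_t\in A\}$, $\tau_x:=\tau_{\{x\}}$, $\tau_x^-:=\tau_{(0,x]}$ for $x\in(0,\infty)$, $\tau_0=\tau_0^-:=\lim_{x\to0}\tau_x^-$. ''No negative jumps'': $\mathbb P_z[\tau_x^-<\tau_y]=0$ for $0<x<y<z$. (A1) $(x,y)\mapsto\mathbb E_x[e^{-\tau_y}]$ is Borel measurable on $(0,\infty)^2$. (A2) $\mathbb P_y[\tau_x<\infty]>0$ for $0<x<y$. (A3) There is a reference measure $m$: a Radon measure on the universally measurable sets of $(0,\infty)$ such that, for universally measurable $B$, $\mathbb E_x[\int_0^\infty e^{-t}1_B(X_t)dt]=0$ for all $x\in(0,\infty)$ iff $m(B)=0$. Local times $(L^x)$ satisfy $\int_0^tf(X_s)ds=\int_{(0,\infty)}f(y)L_t^y\,m(dy)$ $\mathbb P_x$-a.s. for all $t\ge 0$, $x\in(0,\infty)$, measurable $f\ge0$. $n_y$ is the excursion measure away from $y$ associated with $L^y$ (on càdlàg paths starting from and stopped at $y$), normalised by $-\log\mathbb E_y[e^{-q\eta^y_1}]=\delta_yq+n_y[1-e^{-q\tau_y}]$,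 $q\ge0$, for some $\delta_y\ge0$, with $\eta^y$ the right-continuous inverse of $L^y$. Scale functions: for $q\ge0$, $x\in[0,\infty)$, $y\in(0,\infty)$, $W^{(q)}(x,y):=1\{x\le y\}/n_y[e^{-q\tau_x^-},\tau_x^-<\infty]$ ($1/\infty=0$), $W:=W^{(0)}$. With $f\otimes g(x,y):=\int_{(x,y)}f(x,u)g(u,y)m(du)$, $f^{\otimes1}:=f$, $f^{\otimes n}:=f\otimes f^{\otimes(n-1)}$, one has $W^{(q)}(x,y)=\sum_{n\ge0}q^nW^{\otimes(n+1)}(x,y)$, absolutely convergent for all $q\in\mathbb C$; this defines $W^{(q)}$ for $q\in\mathbb C$. Under the present assumptions $\int_{(0,\infty)}W(0,u)m(du)<\infty$, and for $q\in\mathbb C$, $x\in[0,\infty)$, $Z^{(q)}(x):=1+q\int_{(x,\infty)}W^{(q)}(x,u)m(du)$, which is bounded in $x$, entire in $q$, and $Z^{(q)}(\infty):=\lim_{x\to\infty}Z^{(q)}(x)=1$. Extension: $C_\infty(0,\infty]$ is the space of continuous functions on $(0,\infty]$ with limit $0$ at $0$ (supremum norm). Under the present assumptions $X$ extends to a Feller process on $I=(0,\infty]$ (also denoted $X$, killed at $\tau_0$): its transition semigroup $p_tf(x)=\mathbb E_x[f(X_t)]$, $x\in(0,\infty]$, is a strongly continuous positive contraction semigroup on $C_\infty(0,\infty]$, and it coincides with the original one for $x\in(0,\infty)$. Here $m$ is regarded as a measure on $(0,\infty]$ not charging $\{\infty\}$. $\mathcal B_b(I)$ is the set of bounded Borel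 functions on $I$, $\|f\|_\infty:=\sup_{x\in I}|f(x)|$. $\lambda_0:=\sup\{\lambda\ge0\mid\mathbb E_x[e^{\lambda\tau_0}]<\infty\text{ for every }x\in I\}$; under the present assumptions $\lambda_0\in(0,\infty)$, and $\nu_{\lambda_0}(dx):=\lambda_0W^{(-\lambda_0)}(0,x)m(dx)$ is the unique quasi-stationary distribution of $X$. $Z^{(-\lambda_0)}>0$ on $(0,\infty]$ and $\rho:=\frac{d}{dq}Z^{(q)}(0)\big|_{q=-\lambda_0}=\int_{(0,\infty)}W^{(-\lambda_0)}(0,u)Z^{(-\lambda_0)}(u)m(du)\in(0,\infty)$, so $\mu$ is a probability. $\pi_{\lambda_0}f(x):=\frac1{\rho\lambda_0}Z^{(-\lambda_0)}(x)\int_If\,d\nu_{\lambda_0}$. In this setting $\lambda_1>\lambda_0$ and a constant $M_\delta$ as in the claim exists for every $\delta\in(0,\lambda_1-\lambda_0)$. $(q_t)_{t\ge0}$ is the transition semigroup of $X$ conditioned to avoid zero (the $h$-transform of $p_t$ by $Z^{(-\lambda_0)}$). Convention: $\sup\emptyset=-\infty$. *)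

(* Defs.v *)
From HB Require Import structures.
From mathcomp Require Import all_boot all_order all_algebra.
From mathcomp Require Import complex.
From mathcomp Require Import all_classical all_reals all_analysis.
From mathcomp Require Import measurable_realfun.

Set Implicit Arguments.
Unset Strict Implicit.
Unset Printing Implicit Defensive.
Import Order.TTheory GRing.Theory Num.Theory.
Import numFieldNormedType.Exports.
Local Open Scope classical_set_scope.
Local Open Scope ring_scope.

(** All state spaces are subsets of [\bar R]: (0,oo) is [Epos], I = (0,oo] is
    [Iext], and the cemetery is encoded by the value [-oo], which is isolated
    from both. *)
Section state_spaces.
Variable R : realType.

Definition cemetery : \bar R := -oo%E.
Definition Epos : set (\bar R) := [set x | (0 < x < +oo)%E].
Definition Iext : set (\bar R) := [set x | (0 < x)%E].
Definition augmented (E : set (\bar R)) : set (\bar R) := E `|` [set cemetery].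

(** Time is a real number; only nonnegative times are meaningful. *)
Definition hit (e : R -> \bar R) (A : set (\bar R)) : \bar R :=
  ereal_inf [set t%:E | t in [set t : R | 0 < t /\ A (e t)]].

Definition lifetime (e : R -> \bar R) : \bar R :=
  ereal_inf [set t%:E | t in [set t : R | 0 <= t /\ e t = cemetery]].

Definition tau_pt (e : R -> \bar R) (y : \bar R) : \bar R := hit e [set y].

Definition tau0 (e : R -> \bar R) : \bar R :=
  lim (hit e [set u | (0 < u <= z%:E)%E] @[z --> (0 : R)^'+]).

Definition tau_minus (e : R -> \bar R) (x : \bar R) : \bar R :=
  if x == 0%E then tau0 e else hit e [set u | (0 < u <= x)%E].

(** e^{-q s} 1{s < oo} *)
Definition laplace (q : R) (s : \bar R) : \bar R :=
  if s is t%:E then (expR (- (q * t)))%:E else 0%E.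

Definition rc_path (E : set (\bar R)) (e : R -> \bar R) : Prop :=
  (forall t, 0 <= t -> e s @[s --> t^'+] --> e t) /\
  (forall t, 0 < t -> (t%:E < lifetime e)%E ->
     exists2 l, E l & e s @[s --> t^'-] --> l).

Definition killed_path (E : set (\bar R)) (e : R -> \bar R) : Prop :=
  (forall t, 0 <= t -> augmented E (e t)) /\
  (forall s t, 0 <= s -> s <= t -> e s = cemetery -> e t = cemetery).

Definition sup_norm (f : \bar R -> R) : \bar R :=
  ereal_sup [set (`|f x|)%:E | x in Iext].

Definition Bb (f : \bar R -> R) : Prop :=
  measurable_fun Iext f /\ (sup_norm f < +oo)%E.

(** Continuous functions on (0,oo] with limit 0 at 0. *)
Definition Cinfty (f : \bar R -> R) : Prop :=
  {within Iext, continuous f} /\ f x%:E @[x --> (0 : R)^'+] --> (0 : R).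

Definition univ_measurable : set (set (\bar R)) :=
  [set B | forall mu : {finite_measure set (\bar R) -> \bar R},
     exists B1 B2 : set (\bar R),
       [/\ measurable B1, measurable B2, B1 `<=` B, B `<=` B2 &
           mu (B2 `\` B1) = 0%E]].

Definition univ_state := g_sigma_algebraType univ_measurable.

End state_spaces.

Arguments cemetery {R}.
Arguments Epos {R}.
Arguments Iext {R}.

(** The space of cadlag paths in (0,oo) killed at the lifetime, with the
    sigma-algebra generated by the coordinates.  A subtype is needed: hitting
    times are not measurable on the product space of all functions. *)
Section path_space.
Variable R : realType.

Record path := Path {
  path_fun :> R -> \bar R;
  path_killed : killed_path Epos path_fun;
  path_rc : rc_path Epos path_fun }.

Lemma dead_killed : @killed_path R Epos (fun=> cemetery).
Proof. by split=> [t _|s t _ _ _]; [right|]. Qed.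

Lemma dead_rc : @rc_path R Epos (fun=> cemetery).
Proof.
split=> [t _|t t0 tz]; first exact: cvg_cst.
suff : (lifetime (fun=> @cemetery R) <= t%:E)%E by rewrite leNgt tz.
by apply: ereal_inf_lbound; exists t => //; split=> //; exact: ltW.
Qed.

Definition dead_path : path := Path dead_killed dead_rc.

HB.instance Definition _ := gen_eqMixin path.
HB.instance Definition _ := gen_choiceMixin path.
HB.instance Definition _ := isPointed.Build path dead_path.

Definition coordinate_sets : set (set path) :=
  [set A | exists (t : R) (B : set (\bar R)),
     [/\ 0 <= t, measurable B & A = [set e : path | B (e t)]]].

Definition path_space := g_sigma_algebraType coordinate_sets.

End path_space.

(** [law x] is the probability P_x; only x in the augmented state space is
    meaningful. *)
Record process (R : realType) (d : measure_display) (T : measurableType d) :=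
  Process {
    pos : R -> T -> \bar R;
    filt : R -> set (set T);
    shift : R -> T -> T;
    law : \bar R -> probability T R }.

Section processes.
Context {R : realType} {d : measure_display} {T : measurableType d}.
Variable X : process R T.

Definition traj (w : T) : R -> \bar R := fun t => pos X t w.

Section standard.
Variable E : set (\bar R).

Definition initial_law (mu : probability (\bar R) R) : Prop :=
  mu (~` augmented E) = 0%E.

(** P_mu(N) = 0, where P_mu = \int P_x mu(dx). *)
Definition null_from (mu : probability (\bar R) R) (N : set T) : Prop :=
  measurable N /\ {ae mu, forall x, law X x N = 0%E}.

(** P_mu-almost surely, for every initial law mu. *)
Definition almost_surely (Q : T -> Prop) : Prop :=
  forall mu, initial_law mu ->
    exists2 N, null_from mu N & forall w, ~ Q w -> N w.

Definition complete_system (G : set (set T)) : Prop :=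
  forall A, (forall mu, initial_law mu ->
      exists B N, [/\ G B, null_from mu N & A `+` B `<=` N]) -> G A.

Definition usual_filtration : Prop :=
  [/\ forall t, 0 <= t ->
        sigma_algebra setT (filt X t) /\ filt X t `<=` measurable,
      forall s t, 0 <= s -> s <= t -> filt X s `<=` filt X t,
      forall t, 0 <= t ->
        (\bigcap_(s in [set s : R | t < s]) filt X s) `<=` filt X t,
      complete_system measurable &
      forall t, 0 <= t -> complete_system (filt X t)].

Definition stopping_time (S : T -> \bar R) : Prop :=
  (forall w, 0 <= S w)%E /\
  forall t, 0 <= t -> filt X t [set w | (S w <= t%:E)%E].

Definition stopped_events (S : T -> \bar R) : set (set T) :=
  [set A | measurable A /\
     forall t, 0 <= t -> filt X t (A `&` [set w | (S w <= t%:E)%E])].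

Definition pos_at (S : T -> \bar R) (w : T) : \bar R := pos X (fine (S w)) w.

Definition strong_markov : Prop :=
  forall (S : T -> \bar R) (A : set T) (t : R) (B : set (\bar R)) x,
    stopping_time S -> stopped_events S A -> 0 <= t -> measurable B ->
    augmented E x ->
    let A' := A `&` [set w | (S w < +oo)%E] in
    law X x (A' `&` [set w | B (pos X (fine (S w) + t) w)]) =
    (\int[law X x]_(w in A') law X (pos_at S w) (pos X t @^-1` B))%E.

Definition quasi_left_continuous : Prop :=
  forall S : nat -> T -> \bar R,
    (forall n, stopping_time (S n)) ->
    (forall n w, S n w <= S n.+1 w)%E ->
    let Soo := fun w => ereal_sup (range (fun n => S n w)) in
    almost_surely (fun w => (Soo w < lifetime (traj w))%E ->
      pos_at (S n) w @[n --> \oo] --> pos_at Soo w).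

(** Standard process in the sense of Blumenthal and Getoor, with state
    space E. *)
Definition standard_process : Prop :=
  usual_filtration /\
  (forall w, killed_path E (traj w)) /\
  (forall t B, 0 <= t -> measurable B -> filt X t (pos X t @^-1` B)) /\
  (forall s t w, 0 <= s -> 0 <= t -> pos X s (shift X t w) = pos X (s + t) w) /\
  (forall t B, 0 <= t -> measurable B ->
     measurable_fun (augmented E) (fun x => law X x (pos X t @^-1` B))) /\
  (forall x, augmented E x -> law X x [set w | pos X 0 w = x] = 1%E) /\
  almost_surely (fun w => rc_path E (traj w)) /\
  strong_markov /\
  quasi_left_continuous.

End standard.

(** p_t f(x) = E_x[f(X_t)], for f on I extended by 0 at the cemetery. *)
Definition semigroup (t : R) (f : \bar R -> R) (x : \bar R) : R :=
  \int[law X x]_w (f \_ Iext) (pos X t w).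

(** Positivity, contractivity and the semigroup property hold for any Markov
    process. *)
Definition feller_on_I : Prop :=
  [/\ standard_process Iext,
      forall t f, 0 <= t -> Cinfty f -> Cinfty (semigroup t f) &
      forall f, Cinfty f ->
        sup_norm (fun x => semigroup t f x - f x) @[t --> (0 : R)^'+] --> 0%E].

Definition no_negative_jumps : Prop :=
  forall x y z : R, 0 < x -> x < y -> y < z ->
    law X z%:E [set w | (tau_minus (traj w) x%:E < tau_pt (traj w) y%:E)%E]
    = 0%E.

Definition assumption_A1 : Prop :=
  measurable_fun ((@Epos R) `*` (@Epos R))
    (fun xy : \bar R * \bar R =>
       (\int[law X xy.1]_w laplace 1 (tau_pt (traj w) xy.2))%E).

Definition assumption_A2 : Prop :=
  forall x y : R, 0 < x -> x < y ->
    (0 < law X y%:E [set w | (tau_pt (traj w) x%:E < +oo)%E])%E.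

(** The integral of a nonnegative function is a supremum over measurable simple
    functions below it, hence is the expected one also for functions that are
    only measurable for a completion of the sigma-algebra. *)
Definition assumption_A3 (m : {measure set (@univ_state R) -> \bar R}) : Prop :=
  [/\ m (~` Epos) = 0%E,
      forall a b : R, 0 < a -> a <= b ->
        (m [set u | (a%:E <= u <= b%:E)%E] < +oo)%E &
      forall B, univ_measurable B -> B `<=` Epos ->
        (forall x, Epos x ->
           (\int[law X x]_w \int[lebesgue_measure]_(t in `[0%R, +oo[)
              (expR (- t) * \1_B (pos X t w))%:E)%E = 0%E)
        <-> m B = 0%E].

Definition regular_for_itself (y : \bar R) : Prop :=
  law X y [set w | tau_pt (traj w) y = 0%E] = 1%E.

(** [L t w] is the local time at y up to time t.  If y is regular for itself it
    is the continuous additive functional carried by {X = y}; otherwise it is a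
    constant multiple of the number of visits to y during [0,t). *)
Definition local_time_at (y : \bar R) (L : R -> T -> R) : Prop :=
  [/\ forall t (B : set R), 0 <= t -> measurable B ->
        filt X t (L t @^-1` B),
      forall s t, 0 <= s -> 0 <= t ->
        almost_surely Epos (fun w => L (s + t) w = L s w + L t (shift X s w)),
      regular_for_itself y -> almost_surely Epos (fun w =>
        [/\ L 0 w = 0,
            forall s t, 0 <= s -> s <= t -> L s w <= L t w,
            {within `[0, +oo[, continuous (fun t => L t w)} &
            forall s t, 0 <= s -> s <= t ->
              (forall r, s <= r -> r < t -> pos X r w <> y) ->
              L t w = L s w]) &
      ~ regular_for_itself y -> exists2 l : R, 0 < l &
        almost_surely Epos (fun w => forall t, 0 <= t ->
          ((L t w)%:E = l%:E *
             counting [set s : R | [/\ (0 <= s)%R, (s < t)%R &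
                                       pos X s w = y]])%E)].

(** Local times at all levels, as densities of occupation measures. *)
Definition local_times (m : {measure set (@univ_state R) -> \bar R})
    (L : \bar R -> R -> T -> R) : Prop :=
  (forall y, Epos y -> local_time_at y (L y)) /\
  (forall x t (f : \bar R -> \bar R), Epos x -> 0 <= t ->
     measurable_fun Epos f -> (forall u, 0 <= f u)%E ->
     {ae law X x, forall w,
       (\int[lebesgue_measure]_(s in `[0%R, t]) (f \_ Epos) (pos X s w) =
        \int[m]_(u in Epos) (f u * (L u t w)%:E))%E}).

(** Right-continuous inverse of the local time. *)
Definition inverse_local_time (L : R -> T -> R) (s : R) (w : T) : \bar R :=
  ereal_inf [set t%:E | t in [set t : R | 0 <= t /\ s < L t w]].

(** First visit to y strictly after time g. *)
Definition next_visit (y : \bar R) (w : T) (g : R) : \bar R :=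
  ereal_inf [set s%:E | s in [set s : R | g < s /\ pos X s w = y]].

(** g is the left end point of an excursion interval away from y. *)
Definition excursion_start (y : \bar R) (w : T) (g : R) : Prop :=
  closure [set t : R | 0 <= t /\ pos X t w = y] g /\
  (g%:E < next_visit y w g)%E.

(** The excursion starting at g, stopped at y. *)
Definition excursion_path (y : \bar R) (w : T) (g s : R) : \bar R :=
  if ((g + s)%:E < next_visit y w g)%E then pos X (g + s) w else y.

(** [n] is the excursion measure away from y associated with the local time L:
    it is the characteristic measure of the excursions of X counted in the
    scale of L, which is expressed by the compensation formula.  If y is not
    regular for itself, L has jumps of constant size l and the compensation
    formula says that n is 1/l times the law under P_y of X stopped at tau_y;
    the exponent formula then refers to the subordinator obtained by replacing
    the jumps l by independent exponential variables of mean l, for which it is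
    automatic with delta_y = 0. *)
Definition excursion_measure (y : \bar R) (L : R -> T -> R)
    (n : {measure set (@path_space R) -> \bar R}) : Prop :=
  [/\ sigma_finite setT n,
      {ae n, forall e : @path R, e 0 = y /\
         forall t, 0 <= t -> (tau_pt e y <= t%:E)%E -> e t = y},
      forall x (u v : R) (A : set T) (G : set (@path_space R)),
        Epos x -> 0 <= u -> u <= v -> filt X u A -> measurable G ->
        (\int[law X x]_(w in A)
           counting [set g : R | [/\ (u <= g)%R, (g < v)%R, excursion_start y w g &
             exists2 e : @path R, G e &
               forall s, (0 <= s)%R -> e s = excursion_path y w g s]] =
         n G * \int[law X x]_(w in A) (L v w - L u w)%:E)%E &
      regular_for_itself y ->
        exists2 delta : R, 0 <= delta & forall q : R, 0 <= q ->
          (- lne (\int[law X y]_w laplace q (inverse_local_time L 1 w)) =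
           (delta * q)%:E +
             \int[n]_e (1 - laplace q (tau_pt (e : @path R) y)))%E].

Definition decay_rate : R :=
  sup [set lam : R | 0 <= lam /\ forall x, Iext x ->
    (\int[law X x]_w expeR (lam%:E * tau0 (traj w)) < +oo)%E].

End processes.

(** X0 on (0,oo) extends to the process X1 on (0,oo], killed at tau_0. *)
Definition extends_to {R : realType} {d d1 : measure_display}
    {T : measurableType d} {T1 : measurableType d1}
    (X0 : process R T) (X1 : process R T1) : Prop :=
  (forall x t (B : set (\bar R)), Epos x -> 0 <= t -> measurable B ->
     B `<=` Iext ->
     law X1 x (pos X1 t @^-1` B) = law X0 x (pos X0 t @^-1` B)) /\
  (forall x, Iext x ->
     {ae law X1 x, forall w, lifetime (traj X1 w) = tau0 (traj X1 w)}).

Section scale_functions.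
Variable R : realType.
Variable m : {measure set (@univ_state R) -> \bar R}.
Variable n : \bar R -> {measure set (@path_space R) -> \bar R}.

(** W^(0).  In [\bar R], (+oo)^-1 = 0. *)
Definition W0 (x y : \bar R) : \bar R :=
  (if (x <= y)%E then
     (\int[n y]_e laplace 0 (tau_minus (e : @path R) x))^-1
   else 0)%E.

Definition otimes (f g : \bar R -> \bar R -> \bar R) (x y : \bar R) : \bar R :=
  (\int[m]_(u in [set u : \bar R | x < u < y]) (f x u * g u y))%E.

(** [Wpow k] is the (k+1)-st convolution power of W. *)
Fixpoint Wpow (k : nat) : \bar R -> \bar R -> \bar R :=
  if k is k'.+1 then otimes W0 (Wpow k') else W0.

(** Sum of the series of the q^k [Wpow k], by real and imaginary parts. *)
Definition Wq (q : R[i]) (x y : \bar R) : R[i] :=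
  Complex
    (lim (series (fun k => complex.Re (q ^+ k) * fine (Wpow k x y)) @ \oo))
    (lim (series (fun k => complex.Im (q ^+ k) * fine (Wpow k x y)) @ \oo)).

(** At x = +oo the domain of integration is empty and Zq q +oo = 1. *)
Definition Zq (q : R[i]) (x : \bar R) : R[i] :=
  1 + q * Complex
    (\int[m]_(u in [set u : \bar R | (x < u < +oo)%E]) complex.Re (Wq q x u))
    (\int[m]_(u in [set u : \bar R | (x < u < +oo)%E]) complex.Im (Wq q x u)).

Definition Wreal (q : R) (x y : \bar R) : R :=
  complex.Re (Wq (Complex q 0) x y).

Definition Zreal (q : R) (x : \bar R) : R :=
  complex.Re (Zq (Complex q 0) x).

Definition Zzeros : set (R[i]) := [set q | Zq q 0%E = 0].

Definition lambda1 (lam0 : R) : \bar R :=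
  (- ereal_sup [set (complex.Re q)%:E |
       q in Zzeros `\ Complex (- lam0)%R 0%R])%E.

Definition rho (lam0 : R) : R := derive1 (fun q : R => Zreal q 0%E) (- lam0).

(** The measures nu_{lambda_0} and mu are given by their densities with respect
    to m. *)
Definition nu_int (lam0 : R) (f : \bar R -> R) : R :=
  \int[m]_(u in Epos) (f u * (lam0 * Wreal (- lam0) 0%E u)).

Definition pi_op (lam0 : R) (f : \bar R -> R) (x : \bar R) : R :=
  (rho lam0 * lam0)^-1 * Zreal (- lam0) x * nu_int lam0 f.

Definition mu_int (lam0 : R) (f : \bar R -> R) : R :=
  \int[m]_(u in Epos)
    (f u * ((rho lam0)^-1 * Wreal (- lam0) 0%E u * Zreal (- lam0) u)).

Definition h_semigroup {d : measure_display} {T : measurableType d}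
    (X : process R T) (lam0 t : R) (f : \bar R -> R) (x : \bar R) : R :=
  expR (lam0 * t) / Zreal (- lam0) x *
  semigroup X t (fun u => Zreal (- lam0) u * f u) x.

End scale_functions.

(* Main.v *)
(** The bound itself is the hypothesis on [p_t] applied to [f * Z], divided by
    [Z x]; this needs [Z] Borel and positive on I, and [lam0] and [rho] nonzero.
    All of this is extracted from the convergence hypothesis at [f = 1]:
    [exp (lam0 t) P_x(tau_0 > t)] tends uniformly to [h = c Z] at rate
    [exp (- delta t)], where [c = h oo] because [Z oo = 1].
    If [c] were 0, survival probabilities would decay faster than
    [exp (- lam0 t)], against the definition of [lam0] as a supremum; the set
    defining [lam0] is bounded because irreducibility, the strong Feller
    property and compactness of [1, 2] give a geometric lower bound for survival
    from [2, oo].  So [c > 0], and [h] is a nonnegative eigenfunction of [p_t].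
    A zero of [h] would spread to (0,oo) by irreducibility; then survival from
    (0,oo) would be of smaller order than [exp (- lam0 t) = P_oo(X_t = oo)],
    against the Feller property at oo. *)
Require Import Defs.
From HB Require Import structures.
From mathcomp Require Import all_boot all_order all_algebra.
From mathcomp Require Import complex.
From mathcomp Require Import all_classical all_reals all_analysis.
From mathcomp Require Import measurable_realfun ring lra.
Set Implicit Arguments.
Unset Strict Implicit.
Unset Printing Implicit Defensive.
Import Order.TTheory GRing.Theory Num.Theory.
Import numFieldNormedType.Exports.
Local Open Scope classical_set_scope.
Local Open Scope ring_scope.

(** * Integrals of functions that may fail to be measurable *)

(* The densities [W], [Z] and the time [tau0] are not known to be measurable, so
   the usual integral lemmas are needed without that hypothesis. *)
Section integral_without_measurability.
Context d (T : measurableType d) (R : realType).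
Variable mu : {measure set T -> \bar R}.
Local Open Scope ereal_scope.
Import HBNNSimple.

(** A nonnegative integral is a supremum over simple functions below the integrand; setting such a
    function to 0 on [N] keeps its integral and puts it below [g]. *)
Lemma ge0_le_integral_negligible (N : set T) (f g : T -> \bar R) :
  measurable N -> mu N = 0 -> (forall x, 0 <= f x) -> (forall x, 0 <= g x) ->
  (forall x, ~ N x -> f x <= g x) -> \int[mu]_x f x <= \int[mu]_x g x.
Proof.
move=> mN N0 f0 g0 fg; rewrite (ge0_integralTE _ f0) (ge0_integralTE _ g0).
apply/ge_ereal_sup => _ [h hf <-].
have mNc : measurable (~` N) by exact: measurableC.
have -> : sintegral mu h =
    sintegral mu (proj_nnsfun h (mNc : measurable (~` N))).
  rewrite -!integralT_nnsfun.
  apply: ae_eq_integral => //.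
  - exact/measurable_EFinP.
  - exact/measurable_EFinP.
  exists N; split => // x /= hx; apply: contrapT => Nx; apply: hx => _ /=.
  by rewrite mindicE mem_set// mulr1.
apply: ereal_sup_ubound; exists (proj_nnsfun h mNc) => //= x.
rewrite mindicE; have [xN|xN] := boolP (x \in ~` N).
  by rewrite mulr1 (le_trans (hf x))// fg//; move: xN; rewrite inE.
by rewrite mulr0.
Qed.

(** Scaling the simple functions below [f] gives one inequality; the other is the same inequality
    for [k^-1] and [k f]. *)
Lemma ge0_integralZl_nomeasurable (k : R) (f : T -> \bar R) :
  (0 < k)%R -> (forall x, 0 <= f x) ->
  \int[mu]_x (k%:E * f x) = k%:E * \int[mu]_x f x.
Proof.
have half (c : R) (g : T -> \bar R) : (0 < c)%R -> (forall x, 0 <= g x) ->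
    c%:E * \int[mu]_x g x <= \int[mu]_x (c%:E * g x).
  move=> c0 g0; rewrite [X in _ <= X]ge0_integralTE; last first.
    by move=> x; rewrite mule_ge0// lee_fin ltW.
  rewrite -lee_pdivlMl// (ge0_integralTE _ g0).
  apply/ge_ereal_sup => _ [h hg <-]; rewrite lee_pdivlMl// -sintegralrM.
  apply: ereal_sup_ubound; exists (scale_nnsfun h (ltW c0)) => //= x.
  by rewrite EFinM lee_pmul2l// lte_fin.
move=> k0 f0; apply/eqP; rewrite eq_le half// andbT.
have := half k^-1%R (fun x => k%:E * f x).
rewrite invr_gt0 lee_pdivrMl// => /(_ k0); move=> H.
apply: (le_trans (H _)); first by move=> x; rewrite mule_ge0// lee_fin ltW.
rewrite (_ : (fun x => _) = f)//; apply/funext => x.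
by rewrite muleA -EFinM mulVf ?gt_eqF// mul1e.
Qed.

(* [fine] sends both infinities to 0, so that no integrability is needed. *)
Lemma RintegralZl_nomeasurable (D : set T) (k : R) (f : T -> R) : k != 0%R ->
  (\int[mu]_(x in D) (k * f x) = k * \int[mu]_(x in D) f x)%R.
Proof.
move=> kn0; rewrite Rintegral_mkcond [in RHS]Rintegral_mkcond.
have -> : ((fun x => k * f x) \_ D = (fun x => k * (f \_ D) x))%R.
  by apply/funext => x; rewrite /patch; case: ifP => // _; rewrite mulr0.
move: (f \_ D) => {}f; rewrite /Rintegral.
rewrite -[X in fine (integral mu setT X)]/(fun x => k%:E * (f x)%:E).
rewrite integralE [in RHS]integralE.
have neg0 g x : 0 <= (g^\- : T -> \bar R) x by exact: funeneg_ge0.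
have pos0 g x : 0 <= (g^\+ : T -> \bar R) x by exact: funepos_ge0.
set F := (fun y => (f y)%:E).
have A : 0 <= \int[mu]_x F^\+ x by exact: integral_ge0.
have B : 0 <= \int[mu]_x F^\- x by exact: integral_ge0.
case: (ltgtP k 0%R) kn0 => // k0 _.
- rewrite le0_funeposM ?ltW// le0_funenegM ?ltW//.
  rewrite !ge0_integralZl_nomeasurable ?oppr_gt0//.
  case: (\int[mu]_x F^\+ x) A => [a||]// _; case: (\int[mu]_x F^\- x) B => [b||]// _.
  + by rewrite /= mulrBr !mulNr opprK addrC.
  + by rewrite gt0_muley ?lte_fin ?oppr_gt0//= mulr0.
  + by rewrite gt0_muley ?lte_fin ?oppr_gt0//= mulr0.
  + by rewrite gt0_muley ?lte_fin ?oppr_gt0//= mulr0.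
- rewrite ge0_funeposM ?ltW// ge0_funenegM ?ltW//.
  rewrite !ge0_integralZl_nomeasurable//.
  case: (\int[mu]_x F^\+ x) A => [a||]// _; case: (\int[mu]_x F^\- x) B => [b||]// _.
  + by rewrite /= mulrBr.
  + by rewrite gt0_muley ?lte_fin//= mulr0.
  + by rewrite gt0_muley ?lte_fin//= mulr0.
  + by rewrite gt0_muley ?lte_fin//= mulr0.
Qed.

End integral_without_measurability.

(** * Rational times and basic consequences of the standard process axioms *)

Lemma rat_between (R : realType) (a b : R) :
  a < b -> exists q : rat, a < ratr q /\ ratr q < b.
Proof. by move=> /rat_in_itvoo[q]; rewrite in_itv/= => /andP[? ?]; exists q. Qed.

(** Lets countable unions and intersections be formed inside the filtration at a fixed time. *)
Lemma sigma_algebra_measurable (T : pointedType) (G : set (set T)) A :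
  sigma_algebra setT G -> G A <-> measurable (A : set (g_sigma_algebraType G)).
Proof. by move=> sG; rewrite /measurable/= sigma_algebra_id. Qed.

Lemma near_right_rat (R : realType) (t : R) (P : R -> Prop) :
  (\forall s \near t^'+, P s) ->
  forall u, t < u -> exists q : rat, [/\ t < ratr q, ratr q < u & P (ratr q)].
Proof.
move=> [e /= e0 eP] u tu.
have [|q [tq qu]] := @rat_between R t (Num.min (t + e) u).
  by rewrite lt_min ltrDl e0.
move: qu; rewrite lt_min => /andP[qe qu]; exists q; split => //; apply: eP => //=.
by rewrite distrC ger0_norm ?subr_ge0 1?ltW// ltrBlDl.
Qed.

Section standard_process_facts.
Context {R : realType} {d : measure_display} {T : measurableType d}.
Variables (X : process R T) (E : set (\bar R)).
Hypothesis hX : standard_process X E.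

Lemma filt_sigma t : 0 <= t -> sigma_algebra setT (filt X t).
Proof. by move=> t0; have [[+ _ _ _ _] _] := hX; case/(_ t t0). Qed.

Lemma filt_measurable t A : 0 <= t -> filt X t A -> measurable A.
Proof. by move=> t0; have [[+ _ _ _ _] _] := hX; case/(_ t t0) => _; exact. Qed.

Lemma filt_mono s t A : 0 <= s -> s <= t -> filt X s A -> filt X t A.
Proof. by have [[_ + _ _ _] _] := hX => H s0 st; exact: H. Qed.

Lemma filt_right t A : 0 <= t -> (forall s, t < s -> filt X s A) -> filt X t A.
Proof. by have [[_ _ + _ _] _] := hX => H t0 sA; apply: H => // s /= /sA. Qed.

Lemma path_killedE w : killed_path E (traj X w).
Proof. by have [_ [+ _]] := hX. Qed.

Lemma filt_pos t B : 0 <= t -> measurable B -> filt X t (pos X t @^-1` B).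
Proof. by have [_ [_ [+ _]]] := hX; exact. Qed.

Lemma measurable_pos t : 0 <= t -> measurable_fun setT (pos X t).
Proof.
by move=> t0 _ B mB; rewrite setTI; apply: (filt_measurable t0); exact: filt_pos.
Qed.

Lemma measurable_pos_preimage t B : 0 <= t -> measurable B ->
  measurable (pos X t @^-1` B).
Proof. by move=> t0 mB; rewrite -[_ @^-1` _]setTI; exact: measurable_pos. Qed.

Lemma measurable_law t B : 0 <= t -> measurable B ->
  measurable_fun (augmented E) (fun x => law X x (pos X t @^-1` B)).
Proof. by have [_ [_ [_ [_ [+ _]]]]] := hX; exact. Qed.

Lemma law_start x : augmented E x -> law X x [set w | pos X 0 w = x] = 1%E.
Proof. by have [_ [_ [_ [_ [_ [+ _]]]]]] := hX; exact. Qed.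

Lemma pos_augmented t w : 0 <= t -> augmented E (pos X t w).
Proof. by have [+ _] := path_killedE w; exact. Qed.

Lemma lifetime_ge t w : 0 <= t -> pos X t w <> cemetery ->
  (t%:E <= lifetime (traj X w))%E.
Proof.
move=> t0 Xt; apply: le_ereal_inf_tmp => _ [s [s0 Xs] <-].
rewrite lee_fin leNgt; apply/negP => st; apply: Xt.
by have [_ +] := path_killedE w => /(_ s t s0 (ltW st) Xs).
Qed.

Lemma stopping_time_cst s : 0 <= s -> stopping_time X (fun=> s%:E).
Proof.
move=> s0; split => [w|t t0]; first by rewrite lee_fin.
have [f0 fC _] := filt_sigma t0.
have [st|st] := boolP (s%:E <= t%:E)%E.
  have -> : [set _ : T | is_true true] = setT by apply/seteqP; split.
  by rewrite -(setD0 setT); exact: fC.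
by have -> : [set _ : T | is_true false] = set0 by apply/seteqP; split.
Qed.

(** Strong Markov property at a deterministic time, with the whole space as stopped event. *)
Lemma markov_property s t B x : 0 <= s -> 0 <= t -> measurable B ->
  augmented E x ->
  law X x (pos X (s + t) @^-1` B) =
  (\int[law X x]_w law X (pos X s w) (pos X t @^-1` B))%E.
Proof.
move=> s0 t0 mB Ex; have [_ [_ [_ [_ [_ [_ [_ [sm _]]]]]]]] := hX.
have st := stopping_time_cst s0.
have sT : stopped_events X (fun=> s%:E) setT.
  by split => // u u0; rewrite setTI; exact: st.2.
have := sm _ setT t B x st sT t0 mB Ex => /=.
have -> : setT `&` [set w : T | (s%:E < +oo)%E] = setT.
  by apply/seteqP; split => // w _; split => //=; rewrite ltry.
by rewrite setTI.
Qed.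

Lemma rc_path_ae mu : initial_law E mu ->
  exists2 N, null_from X mu N & forall w, ~ N w -> rc_path E (traj X w).
Proof.
have [_ [_ [_ [_ [_ [_ [+ _]]]]]]] := hX => /[apply] -[N nN NP]; exists N => // w.
by apply: contra_notP => /NP.
Qed.

Lemma null_fromU mu N1 N2 : null_from X mu N1 -> null_from X mu N2 ->
  null_from X mu (N1 `|` N2).
Proof.
move=> [m1 a1] [m2 a2]; split; first exact: measurableU.
by apply: filterS2 a1 a2 => x x1 x2; exact: null_set_setU.
Qed.

End standard_process_facts.

(** * Measurability of the event that a point is hit *)

(* The value of a measure on a non-measurable set carries no information, so
   positivity of the hitting probabilities is usable only once the hitting event
   is known to be measurable.  The point [y] is approached by neighbourhoods,
   whose rational hitting times are exact stopping times; quasi-left-continuity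
   identifies their limit almost surely, and completeness does the rest. *)
Section debut.
Context {R : realType} {d : measure_display} {T : measurableType d}.
Variables (X : process R T) (E : set (\bar R)).
Hypothesis hX : standard_process X E.
Variable y : R.

Let nbh (n : nat) : set (\bar R) :=
  [set u | ((y - n.+1%:R^-1)%:E < u < (y + n.+1%:R^-1)%:E)%E].

(** At its rational hitting time of [nbh n] a right-continuous path need only be in the closed
    interval. *)
Let cnbh (n : nat) : set (\bar R) :=
  [set u | ((y - n.+1%:R^-1)%:E <= u <= (y + n.+1%:R^-1)%:E)%E].

Let sub_cnbh n : nbh n `<=` cnbh n.
Proof. by move=> u /= /andP[a b]; apply/andP; split; exact: ltW. Qed.

Let mnbh n : measurable (nbh n).
Proof. by rewrite /nbh -set_itvoo; exact: emeasurable_itv. Qed.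

Let nbh_nbhs n : nbhs (y%:E) (nbh n).
Proof.
have -> : nbh n = [set u | ((y - n.+1%:R^-1)%:E < u)%E] `&`
                 [set u | (u < (y + n.+1%:R^-1)%:E)%E].
  by apply/seteqP; split => u => [/andP[]|[a b]]; last exact/andP.
apply: filterI.
- apply: open_nbhs_nbhs; split; first exact: open_ereal_gt_ereal.
  by rewrite /= lte_fin ltrBlDr ltrDl invr_gt0.
- apply: open_nbhs_nbhs; split; first exact: open_ereal_lt_ereal.
  by rewrite /= lte_fin ltrDl invr_gt0.
Qed.

Let closed_cnbh n : closed (cnbh n).
Proof.
have -> : cnbh n = [set u | ((y - n.+1%:R^-1)%:E <= u)%E] `&`
                 [set u | (u <= (y + n.+1%:R^-1)%:E)%E].
  by apply/seteqP; split => u => [/andP[]|[a b]]; last exact/andP.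
by apply: closedI; [exact: closed_ereal_le_ereal|exact: closed_ereal_ge_ereal].
Qed.

Let cnbh_le m n : (m <= n)%N -> cnbh n `<=` cnbh m.
Proof.
move=> mn u /= /andP[a b].
have le : n.+1%:R^-1 <= m.+1%:R^-1 :> R by rewrite lef_pV2 ?posrE// ler_nat.
apply/andP; split.
- by apply: le_trans a; rewrite lee_fin lerD2l lerN2.
- by apply: le_trans b _; rewrite lee_fin lerD2l.
Qed.

Let nbh_le n : nbh n.+1 `<=` nbh n.
Proof.
move=> u /= /andP[a b].
have le : n.+2%:R^-1 <= n.+1%:R^-1 :> R by rewrite lef_pV2 ?posrE// ler_nat.
apply/andP; split.
- by apply: le_lt_trans a; rewrite lee_fin lerD2l lerN2.
- by apply: lt_le_trans b _; rewrite lee_fin lerD2l.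
Qed.

Let bigcap_cnbh u : (forall n, cnbh n u) -> u = y%:E.
Proof.
move=> H; have : u \is a fin_num.
  have /andP[a b] := H 0%N; rewrite fin_numElt.
  by rewrite (lt_le_trans _ a) ?ltNyr// (le_lt_trans b)// ltry.
move/fineK => uE; rewrite -uE in H *; congr EFin; apply/eqP.
rewrite eq_le; apply/andP; split; rewrite leNgt; apply/negP.
- move/ltr_add_invr => [k yk]; have /andP[_] := H k.
  by rewrite lee_fin leNgt yk.
- move/ltr_add_invr => [k yk]; have /andP[+ _] := H k.
  by rewrite lee_fin lerBlDr leNgt yk.
Qed.

Variable eps : R.
Hypothesis eps0 : 0 < eps.

(** Rational times turn strict sublevel events into countable unions; [eps] keeps a visit at time 0
    from counting. *)
Let hit_rat (n : nat) (w : T) : \bar R := ereal_inf [set t%:E | t in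
  [set t : R | exists q : rat, [/\ t = ratr q, eps <= t & nbh n (pos X t w)]]].

Let hit_rat_ge n w : (eps%:E <= hit_rat n w)%E.
Proof.
by apply: le_ereal_inf_tmp => _ [t [q [_ et _]] <-]; rewrite lee_fin.
Qed.

Let hit_rat_ltP n w (s : R) : (hit_rat n w < s%:E)%E <->
  exists q : rat, [/\ eps <= ratr q, ratr q < s & nbh n (pos X (ratr q) w)].
Proof.
split.
- by move=> /ereal_inf_lt[_ [t [q [-> eq nq]] <-]]; rewrite lte_fin; exists q.
- move=> [q [eq qs nq]]; apply: (@le_lt_trans _ _ (ratr q)%:E).
    by apply: ereal_inf_lbound; exists (ratr q) => //; exists q.
  by rewrite lte_fin.
Qed.

Let filt_hit_rat_lt n s : 0 <= s ->
  filt X s [set w | (hit_rat n w < s%:E)%E].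
Proof.
move=> s0; apply/(sigma_algebra_measurable _ (filt_sigma hX s0)).
have -> : [set w | (hit_rat n w < s%:E)%E] = \bigcup_(q : rat)
    (if (eps <= ratr q) && (ratr q < s) then pos X (ratr q) @^-1` nbh n
     else set0).
  apply/seteqP; split => [w /= /hit_rat_ltP[q [eq qs nq]]|w [q _]].
    by exists q => //; rewrite eq qs.
  case: ifP => // /andP[eq qs] nq; apply/hit_rat_ltP; by exists q.
apply: bigcupT_measurable_rat => q; case: ifP => // /andP[eq qs].
apply/(sigma_algebra_measurable _ (filt_sigma hX s0)).
have q0 : 0 <= ratr q :> R by rewrite (le_trans _ eq)// ltW.
by apply: (filt_mono hX q0 (ltW qs)); exact: (filt_pos hX).
Qed.

(** For every [s > t], the event [hit_rat <= t] is a countable intersection of events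
    [hit_rat < t + (s - t) / (k + 1)] known at time [s]; right-continuity of the filtration brings
    it back to [t]. *)
Let stopping_hit_rat n : stopping_time X (hit_rat n).
Proof.
split => [w|t t0]; first by rewrite (le_trans _ (hit_rat_ge n w))// lee_fin ltW.
apply: (filt_right hX) => // s ts.
have s0 : 0 <= s by rewrite (le_trans t0)// ltW.
have -> : [set w | (hit_rat n w <= t%:E)%E] =
    \bigcap_k [set w | (hit_rat n w < (t + (s - t) / k.+1%:R)%:E)%E].
  have st0 : 0 < s - t by rewrite subr_gt0.
  apply/seteqP; split => [w /= tw k _ /=|w /= H].
    by rewrite (le_lt_trans tw)// lte_fin ltrDl divr_gt0.
  rewrite leNgt; apply/negP => tw.
  have [r tr] : exists2 r : R, (t < r) & (r%:E <= hit_rat n w)%E.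
    case: (hit_rat n w) tw => [a||]//=; first by exists a.
    by exists (t + 1); rewrite ?ltrDl// leey.
  move=> rw; have : 0 < (r - t) / (s - t) by rewrite divr_gt0// subr_gt0.
  move/ltr_add_invr => [k]; rewrite add0r => kr.
  have := H k I; rewrite /= ltNge; move/negP; apply.
  apply: le_trans rw; rewrite lee_fin -lerBrDl mulrC -ler_pdivlMr//.
  exact: ltW.
apply/(sigma_algebra_measurable _ (filt_sigma hX s0)).
apply: bigcapT_measurable => k.
apply/(sigma_algebra_measurable _ (filt_sigma hX s0)).
have k1 : t + (s - t) / k.+1%:R <= s.
  rewrite -lerBrDl ler_pdivrMr// ler_peMr ?ler1n//.
  by rewrite subr_ge0 ltW.
have k0 : 0 <= t + (s - t) / k.+1%:R.
  by rewrite addr_ge0// divr_ge0// subr_ge0 ltW.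
by apply: (filt_mono hX k0 k1); exact: filt_hit_rat_lt.
Qed.

Let hit_rat_mono n w : (hit_rat n w <= hit_rat n.+1 w)%E.
Proof.
apply: ereal_inf_le_tmp => _ [t [q [tq et /nbh_le nt]] <-].
by exists t => //; exists q.
Qed.

(** Otherwise right-continuity keeps the path out of the closed interval just after [r], where the
    infimum [r] forces rational visits to [nbh n]. *)
Let pos_hit_rat n w r : rc_path E (traj X w) -> hit_rat n w = r%:E ->
  cnbh n (pos X r w).
Proof.
move=> [rc _] wr; apply: contrapT => Nc.
have r0 : 0 <= r.
  by rewrite -lee_fin -wr (le_trans _ (hit_rat_ge n w))// lee_fin ltW.
have : \forall s \near r^'+, (~` cnbh n) (pos X s w).
  apply: (rc r r0 (~` cnbh n)); apply: open_nbhs_nbhs; split => //.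
  exact: closed_openC.
move=> [e /= e0 He].
have : (hit_rat n w < (r + e)%:E)%E by rewrite wr lte_fin ltrDl.
move/hit_rat_ltP => [q [eq qe nq]].
have : (r%:E <= (ratr q)%:E)%E.
  by rewrite -wr; apply: ereal_inf_lbound; exists (ratr q) => //; exists q.
rewrite lee_fin le_eqVlt => /predU1P[rq|rq].
  by apply: Nc; rewrite rq; exact: sub_cnbh.
have := He (ratr q); rewrite /= distrC ger0_norm ?subr_ge0 1?ltW// ltrBlDl.
by move=> /(_ qe rq); apply; exact: sub_cnbh.
Qed.

Let sup_hit_rat w := ereal_sup (range (fun n => hit_rat n w)).

(** Countable form of the event that the supremum of the hitting times precedes the lifetime; it
    agrees with the hitting event up to a null set. *)
Let alive_after := \bigcup_(q : rat) \bigcup_(r : rat)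
  (if (0 <= ratr q :> R) && (ratr q < ratr r :> R) then
     [set w | (sup_hit_rat w <= (ratr q)%:E)%E] `&`
     (pos X (ratr r) @^-1` (~` [set cemetery])) else set0).

Let measurable_alive_after : measurable alive_after.
Proof.
apply: bigcupT_measurable_rat => q; apply: bigcupT_measurable_rat => r.
case: ifP => // /andP[q0 qr]; apply: measurableI; last first.
  apply: (measurable_pos_preimage hX); first by rewrite (le_trans q0)// ltW.
  exact: measurableC.
have -> : [set w | (sup_hit_rat w <= (ratr q)%:E)%E] =
    \bigcap_n [set w | (hit_rat n w <= (ratr q)%:E)%E].
  apply/seteqP; split => [w /= wq n _ /=|w /= H].
    by apply: le_trans wq; apply: ereal_sup_ubound; exists n.
  by apply: ge_ereal_sup => _ [n _ <-]; exact: H.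
apply: bigcapT_measurable => n; apply: (filt_measurable hX q0).
by have [_] := stopping_hit_rat n; exact.
Qed.

Let sup_hit_rat_ge w : (eps%:E <= sup_hit_rat w)%E.
Proof.
by apply: (le_trans (hit_rat_ge 0 w)); apply: ereal_sup_ubound; exists 0%N.
Qed.

Let alive_afterP w : alive_after w <-> (sup_hit_rat w < lifetime (traj X w))%E.
Proof.
split=> [[q _ [r _]]|].
  case: ifP => // /andP[q0 qr] [/= wq Xr]; apply: (le_lt_trans wq).
  apply: (@lt_le_trans _ _ (ratr r)%:E); first by rewrite lte_fin.
  by apply: (lifetime_ge hX) => //; rewrite (le_trans q0)// ltW.
have := sup_hit_rat_ge w; case wE : (sup_hit_rat w) => [s||]//; last first.
  by move=> _; rewrite ltNge leey.
move=> es slt.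
have s0 : 0 <= s by rewrite -lee_fin (le_trans _ es)// lee_fin ltW.
have [u su ul] : exists2 u : R, s < u & (u%:E <= lifetime (traj X w))%E.
  case: (lifetime (traj X w)) slt => [l||]//=; first by exists l.
  by exists (s + 1); rewrite ?ltrDl// leey.
have [r [sr ru]] := rat_between su; have [q [sq qr]] := rat_between sr.
have q0 : 0 <= ratr q :> R by rewrite (le_trans s0)// ltW.
exists q => //; exists r => //; rewrite q0 qr /=; split.
  by rewrite /= wE lee_fin ltW.
move=> /= Xr; suff : (lifetime (traj X w) <= (ratr r)%:E)%E.
  by rewrite leNgt (lt_le_trans _ ul)// lte_fin.
apply: ereal_inf_lbound; exists (ratr r) => //; split => //.
by rewrite (le_trans q0)// ltW.
Qed.

(** Just after [t] the path is in every [nbh n], so the supremum is at most [t]; being near [y], the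
    path is also still alive there. *)
Lemma hits_after_alive w : rc_path E (traj X w) ->
  (exists2 t, eps <= t & pos X t w = y%:E) -> alive_after w.
Proof.
move=> [rc _] [t et Xt]; apply/alive_afterP.
have t0 : 0 <= t by rewrite (le_trans _ et)// ltW.
have near_nbh n : \forall s \near t^'+, nbh n (pos X s w).
  by apply: (rc t t0 (nbh n)); rewrite /traj Xt.
have st : (sup_hit_rat w <= t%:E)%E.
  apply: ge_ereal_sup => _ [n _ <-]; rewrite leNgt; apply/negP => tw.
  have [u tu uw] : exists2 u : R, (t < u) & (u%:E <= hit_rat n w)%E.
    case: (hit_rat n w) tw => [a||]//=; first by exists a.
    by exists (t + 1); rewrite ?ltrDl// leey.
  have [q [tq qu nq]] := near_right_rat (near_nbh n) tu.
  have : (hit_rat n w < u%:E)%E.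
    by apply/hit_rat_ltP; exists q; split => //; rewrite (le_trans et)// ltW.
  by rewrite ltNge uw.
have [q [tq qu /andP[nq _]]] := near_right_rat (near_nbh 0%N) (ltr_pwDr ltr01 (lexx t)).
apply: (le_lt_trans st); apply: (@lt_le_trans _ _ (ratr q)%:E); first by rewrite lte_fin.
apply: (lifetime_ge hX); first by rewrite (le_trans t0)// ltW.
by move=> Xq; move: nq; rewrite Xq.
Qed.

(** Quasi-left-continuity makes the positions at the times [hit_rat n] converge to the position at
    their supremum; the limit lies in every closed interval, so it is [y]. *)
Let hits_of_alive w : rc_path E (traj X w) ->
  ((sup_hit_rat w < lifetime (traj X w))%E ->
    pos_at X (hit_rat n) w @[n --> \oo] --> pos_at X sup_hit_rat w) ->
  alive_after w -> exists2 t, eps <= t & pos X t w = y%:E.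
Proof.
move=> rc qlc /alive_afterP aw; have := qlc aw; rewrite /pos_at.
have := sup_hit_rat_ge w; case wE : (sup_hit_rat w) aw => [s||]//; last by rewrite ltNge leey.
move=> aw es cv.
exists s; first by rewrite -lee_fin.
apply: bigcap_cnbh => k; apply: (closed_cvg (cnbh k) (@closed_cnbh k) _ _ cv).
near=> n; have kn : (k <= n)%N by near: n; exact: nbhs_infty_ge.
apply: (cnbh_le kn); apply: pos_hit_rat => //.
have ns : (hit_rat n w <= s%:E)%E.
  by rewrite -wE; apply: ereal_sup_ubound; exists n.
by have := hit_rat_ge n w; case: (hit_rat n w) ns.
Unshelve. all: by end_near. Qed.

Lemma measurable_hits_after :
  measurable [set w | exists2 t, eps <= t & pos X t w = y%:E].
Proof.
have [[_ _ _ cplt _] _] := hX; apply: cplt => mu mu0.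
have [N1 N1n N1P] := rc_path_ae hX mu0.
have [_ [_ [_ [_ [_ [_ [_ [_ qlc]]]]]]]] := hX.
have [N2 N2n N2P] := qlc hit_rat stopping_hit_rat hit_rat_mono mu mu0.
(* The hitting event and [alive_after] differ at most where right-continuity or
   quasi-left-continuity fails. *)
exists alive_after, (N1 `|` N2); split => //; first exact: null_fromU.
move=> w wD; apply: contrapT => /not_orP[/N1P rc N2w].
have {}N2w := contrapT (fun nQ => N2w (N2P w nQ)).
case: wD => -[]; first by move=> hw; apply; exact: (hits_after_alive rc hw).
by move=> aw; apply; exact: (hits_of_alive rc N2w aw).
Qed.

End debut.

(** A visit at a positive time occurs at or after [1 / (n + 1)] for some [n]. *)
Lemma measurable_tau_pt_finite (R : realType) d (T : measurableType d)
    (X : process R T) (E : set (\bar R)) (y : R) : standard_process X E ->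
  measurable [set w | (tau_pt (traj X w) y%:E < +oo)%E].
Proof.
move=> hX.
have -> : [set w | (tau_pt (traj X w) y%:E < +oo)%E] =
    \bigcup_n [set w | exists2 t, n.+1%:R^-1 <= t & pos X t w = y%:E].
  apply/seteqP; split => [w /ereal_inf_lt[_ [t [t0 Xt] <-] _]|w [n _ [t nt Xt]]].
    have [n] := ltr_add_invr t0; rewrite add0r => nt.
    by exists n => //; exists t => //; exact: ltW.
  apply: (@le_lt_trans _ _ t%:E); last by rewrite ltry.
  by apply: ereal_inf_lbound; exists t => //; split => //; exact: lt_le_trans nt.
by apply: bigcupT_measurable => n; apply: (measurable_hits_after hX).
Qed.

(** * From hitting a point to being near it at a fixed time *)

Section reaching_open_sets.
Context {R : realType} {d : measure_display} {T : measurableType d}.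
Variables (X : process R T) (E : set (\bar R)).
Hypothesis hX : standard_process X E.

(** Under the Dirac mass at [x] as initial law, an almost sure property holds from [x] itself. *)
Lemma rc_path_law x : augmented E x ->
  exists N, [/\ measurable N, law X x N = 0%E &
    forall w, ~ N w -> rc_path E (traj X w)].
Proof.
move=> Ex.
have mu0 : initial_law E (\d_x : probability (\bar R) R).
  by rewrite /initial_law /= diracE memNset//=; apply.
have [N [mN [A [mA A0 HA]]] NP] := rc_path_ae hX mu0.
exists N; split => //; apply: contrapT => Nx.
have Ax : A x by apply: HA.
by move: A0; rewrite /= diracE mem_set// => /eqP; rewrite onee_eq0.
Qed.

(* If every rational time missed [U], right-continuity would make the hitting
   event of [y] null. *)
Lemma reaches_nbhs x (y : R) (U : set (\bar R)) : augmented E x ->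
  measurable U -> nbhs (y%:E) U ->
  (0 < law X x [set w | (tau_pt (traj X w) y%:E < +oo)%E])%E ->
  exists2 s, 0 < s & (0 < law X x (pos X s @^-1` U))%E.
Proof.
move=> Ex mU nU hit0; apply: contrapT => H.
have [N [mN N0 NP]] := rc_path_law Ex.
pose A := \bigcup_(q : rat) (if (0 < ratr q :> R) then pos X (ratr q) @^-1` U
  else set0).
have mA q : measurable (if (0 < ratr q :> R) then pos X (ratr q) @^-1` U
    else set0).
  by case: ifP => // q0; apply: (measurable_pos_preimage hX) => //; exact: ltW.
have A0 : law X x A = 0%E.
  apply: measure_negligible; first exact: bigcupT_measurable_rat.
  have -> : A = \bigcup_n (if unpickle n is Some q then
      (if (0 < ratr q :> R) then pos X (ratr q) @^-1` U else set0) else set0).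
    apply/seteqP; split => [w [q _ qw]|w [n _]].
      exists (pickle q); first exact: I.
      by rewrite pickleK; exact: qw.
    by case: unpickle => // q qw; exists q.
  apply: negligible_bigcup => n; case: unpickle => [q|]; last exact: negligible_set0.
  apply/negligibleP; first exact: mA.
  case: ifP => [q0|_]; last exact: measure0.
  apply: contrapT => /eqP U0; apply: H; exists (ratr q) => //.
  by rewrite lt0e U0 measure_ge0.
have : (law X x [set w | (tau_pt (traj X w) y%:E < +oo)%E] <= law X x (N `|` A))%E.
  apply: le_measure; rewrite ?inE.
  - exact: (measurable_tau_pt_finite y hX).
  - by apply: measurableU => //; exact: bigcupT_measurable_rat.
  move=> w /ereal_inf_lt[_ [t [t0 Xt] <-] _]; apply: contrapT => /not_orP[/NP [rc _] Aw].
  apply: Aw; have : \forall s \near t^'+, U (pos X s w).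
    by apply: (rc t (ltW t0) U); rewrite Xt.
  move/near_right_rat => /(_ (t + 1)); rewrite ltrDl ltr01 => /(_ isT)[q [tq _ Uq]].
  by exists q => //; rewrite (lt_trans t0 tq).
rewrite null_set_setU// ?leNgt ?hit0//; exact: bigcupT_measurable_rat.
Qed.
End reaching_open_sets.

(** * The semigroup on bounded functions and survival probabilities *)

Section semigroup_facts.
Context {R : realType} {d : measure_display} {T : measurableType d}.
Variables (X : process R T).
Hypothesis hX : standard_process X Iext.
Implicit Types (f g : \bar R -> R) (x : \bar R) (t : R).

Lemma measurable_Iext : measurable (@Iext R).
Proof.
by have := @emeasurable_itv R `]0%E, +oo[; rewrite set_itvoy.
Qed.

Lemma sup_norm_leP f (C : R) :
  (sup_norm f <= C%:E)%E <-> (forall x, Iext x -> `|f x| <= C).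
Proof.
split=> [fC x xI|fC].
  rewrite -lee_fin; apply: le_trans fC.
  by apply: ereal_sup_ubound; exists x.
by apply: ge_ereal_sup => _ [x xI <-]; rewrite lee_fin fC.
Qed.

Lemma Bb_bounded f (C : R) : measurable_fun Iext f ->
  (forall x, Iext x -> `|f x| <= C) -> Bb f.
Proof.
by move=> mf /sup_norm_leP fC; split => //; rewrite (le_lt_trans fC)// ltry.
Qed.

Lemma measurable_semigroup_integrand t f : 0 <= t -> measurable_fun Iext f ->
  measurable_fun setT (fun w => (f \_ Iext) (pos X t w)).
Proof.
move=> t0 mf; apply: (measurableT_comp (f := f \_ Iext)).
  by apply/(measurable_restrictT f measurable_Iext).
exact: (measurable_pos hX).
Qed.

Lemma patch_bounded f (C : R) : 0 <= C -> (forall x, Iext x -> `|f x| <= C) ->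
  forall y, `|(f \_ Iext) y| <= C.
Proof.
move=> C0 fC y; rewrite /patch; case: ifPn => [|_]; last by rewrite normr0.
by rewrite inE => /fC.
Qed.

Lemma integrable_semigroup t f (C : R) x : 0 <= t -> measurable_fun Iext f ->
  (forall x, Iext x -> `|f x| <= C) ->
  (law X x).-integrable setT (EFin \o (fun w => (f \_ Iext) (pos X t w))).
Proof.
move=> t0 mf fC.
have C0 : 0 <= C by rewrite (le_trans _ (fC +oo%E _))//= /Iext/= ltry.
apply: measurable_bounded_integrable => //.
- by rewrite (le_lt_trans (probability_le1 _ _))// ltry.
- exact: measurable_semigroup_integrand.
exists C; split => [|M CM w _ /=]; first by rewrite num_real.
by rewrite (le_trans (patch_bounded C0 fC _))// ltW.
Qed.

Lemma semigroup_le t f g (Cf Cg : R) x : 0 <= t ->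
  measurable_fun Iext f -> measurable_fun Iext g ->
  (forall x, Iext x -> `|f x| <= Cf) -> (forall x, Iext x -> `|g x| <= Cg) ->
  (forall x, Iext x -> f x <= g x) -> semigroup X t f x <= semigroup X t g x.
Proof.
move=> t0 mf mg fC gC fg; apply: le_Rintegral => //.
- exact: integrable_semigroup fC.
- exact: integrable_semigroup gC.
by move=> w _; rewrite /patch; case: ifPn => //; rewrite inE => /fg.
Qed.

Lemma semigroupB t f g (Cf Cg : R) x : 0 <= t ->
  measurable_fun Iext f -> measurable_fun Iext g ->
  (forall x, Iext x -> `|f x| <= Cf) -> (forall x, Iext x -> `|g x| <= Cg) ->
  semigroup X t (fun u => f u - g u) x = semigroup X t f x - semigroup X t g x.
Proof.
move=> t0 mf mg fC gC; rewrite /semigroup -RintegralB//; last 2 first.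
- exact: integrable_semigroup fC.
- exact: integrable_semigroup gC.
congr (Rintegral _ _ _); apply/funext => w.
by rewrite /patch; case: ifPn => //; rewrite subr0.
Qed.

Lemma semigroupZ t f (k : R) x : semigroup X t (fun u => k * f u) x =
  k * semigroup X t f x.
Proof.
have kE : (fun w => ((fun u => k * f u) \_ Iext) (pos X t w)) =
    (fun w => k * (f \_ Iext) (pos X t w)).
  by apply/funext => w; rewrite /patch; case: ifPn => //; rewrite mulr0.
rewrite /semigroup kE; have [->|k0] := eqVneq k 0; last first.
  exact: RintegralZl_nomeasurable.
rewrite mul0r (_ : (fun w => _) = cst 0) ?Rintegral_cst ?mul0r//.
by apply/funext => w; rewrite mul0r.
Qed.

Lemma semigroup_norm t f (C : R) x : 0 <= t -> measurable_fun Iext f ->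
  (forall x, Iext x -> `|f x| <= C) -> `|semigroup X t f x| <= C.
Proof.
move=> t0 mf fC.
have C0 : 0 <= C by rewrite (le_trans _ (fC +oo%E _))//= /Iext/= ltry.
have iC : (law X x).-integrable setT (EFin \o cst C).
  by apply: finite_measure_integrable_cst.
rewrite /semigroup; apply: (le_trans (le_normr_Rintegral _ _)) => //.
  exact: integrable_semigroup fC.
apply: (@le_trans _ _ (\int[law X x]_w cst C w)).
  apply: le_Rintegral => //.
    have := integrable_abse (integrable_semigroup x t0 mf fC).
    by apply: eq_integrable => //.
  by move=> w _; exact: patch_bounded.
rewrite Rintegral_cst//.
by rewrite (_ : fine _ = 1) ?mulr1//; exact: (congr1 fine (probability_setT (law X x))).
Qed.

Lemma semigroup_indic t (B : set (\bar R)) x : 0 <= t -> measurable B ->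
  semigroup X t \1_B x = fine (law X x (pos X t @^-1` (B `&` Iext))).
Proof.
move=> t0 mB; rewrite /semigroup /Rintegral; congr fine.
have mBI : measurable (pos X t @^-1` (B `&` Iext)).
  apply: (measurable_pos_preimage hX) => //; apply: measurableI => //.
  exact: measurable_Iext.
rewrite -[pos X t @^-1` _]setIT -integral_indic//.
apply: eq_integral => w _; congr EFin; rewrite /patch !indicE.
rewrite -[w \in _]/(pos X t w \in B `&` Iext) in_setI.
by case: ifPn; rewrite ?andbT ?andbF.
Qed.

Lemma measurable_indic_Iext (B : set (\bar R)) :
  measurable B -> measurable_fun Iext (\1_B : \bar R -> R).
Proof. by move=> mB; apply: measurable_funTS; exact: measurable_indic. Qed.

Lemma indic_bounded (B : set (\bar R)) (u : \bar R) : `|\1_B u : R| <= 1.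
Proof. by rewrite indicE; case: (_ \in _); rewrite ?normr1 ?normr0. Qed.

(** The process starts at [cemetery] almost surely and never leaves it, so dead positions add
    nothing to later survival. *)
Lemma law_cemetery t (B : set (\bar R)) : 0 <= t -> measurable B ->
  ~ B cemetery -> law X cemetery (pos X t @^-1` B) = 0%E.
Proof.
move=> t0 mB Bc; apply/eqP; rewrite eq_le measure_ge0 andbT.
have aug : augmented Iext (@cemetery R) by right.
have := law_start hX aug => start.
have m0 : measurable [set w | pos X 0 w = cemetery].
  by apply: (measurable_pos_preimage hX (B := [set cemetery])).
have : (law X cemetery (~` [set w | pos X 0 w = cemetery]) = 0)%E.
  rewrite probability_setC// start subee//.
move=> <-; apply: le_measure; rewrite ?inE.
- exact: (measurable_pos_preimage hX).
- exact: measurableC.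
move=> w /= Bw X0; apply: Bc; rewrite /= in Bw *.
by have [_ +] := path_killedE hX w => /(_ 0 t (lexx _) t0 X0) <-.
Qed.

(** For a process killed at [tau0] this is the probability of [tau0 > t]; it equals [p_t 1], to
    which the convergence hypothesis applies. *)
Definition survival t x : R := fine (law X x (pos X t @^-1` Iext)).

Lemma survivalE t x : 0 <= t ->
  (survival t x)%:E = law X x (pos X t @^-1` Iext).
Proof.
move=> t0; rewrite fineK// fin_num_measure//.
by apply: (measurable_pos_preimage hX) => //; exact: measurable_Iext.
Qed.

Lemma survival_ge0 t x : 0 <= survival t x.
Proof. by rewrite fine_ge0. Qed.

Lemma survival_le1 t x : 0 <= t -> survival t x <= 1.
Proof.
move=> t0; rewrite -lee_fin survivalE//; apply: probability_le1.
by apply: (measurable_pos_preimage hX) => //; exact: measurable_Iext.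
Qed.

Lemma semigroup1 t x : 0 <= t -> semigroup X t (\1_Iext) x = survival t x.
Proof. by move=> t0; rewrite (semigroup_indic _ t0) ?setIid//; exact: measurable_Iext. Qed.

Lemma measurable_survival t : 0 <= t -> measurable_fun Iext (survival t).
Proof.
move=> t0; apply: (measurableT_comp (f := fine)) => //.
have mE : measurable (augmented (@Iext R)).
  by apply: measurableU => //; exact: measurable_Iext.
apply: (measurable_funS mE); first by left.
by apply: (measurable_law hX) => //; exact: measurable_Iext.
Qed.

Lemma semigroup_survival s t x : 0 <= s -> 0 <= t -> Iext x ->
  semigroup X s (survival t) x = survival (s + t) x.
Proof.
move=> s0 t0 xI; rewrite /survival (markov_property hX s0 t0 measurable_Iext (or_introl xI)).
congr fine; apply: eq_integral => w _.
rewrite /patch; case: ifPn => [_|]; first by rewrite survivalE.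
rewrite notin_setE => wI.
have [//|->] := pos_augmented hX w s0.
by rewrite law_cemetery//; exact: measurable_Iext.
Qed.

Lemma survival_decr s t x : 0 <= s -> s <= t -> survival t x <= survival s x.
Proof.
move=> s0 st; rewrite -lee_fin !survivalE//; last exact: le_trans st.
apply: le_measure; rewrite ?inE.
- by apply: (measurable_pos_preimage hX); [exact: le_trans st|exact: measurable_Iext].
- by apply: (measurable_pos_preimage hX) => //; exact: measurable_Iext.
move=> w wt; have [//|Xs] := pos_augmented hX w s0.
have [_ +] := path_killedE hX w => /(_ s t s0 st Xs) Xt.
by move: wt; rewrite /= -[pos X t w]/(traj X w t) Xt.
Qed.

End semigroup_facts.

(** * A continuous test function for the Feller property *)

Section cutoff.
Variable R : realType.

(** Equal to 1 on [2, oo], below the indicator of (1, oo] and vanishing near 0, so that the Feller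
    property can be used to estimate indicators. *)
Definition cutoff (u : \bar R) : R :=
  match u with
  | r%:E => Num.min 1 (Num.max 0 (r - 1))
  | +oo%E => 1
  | -oo%E => 0
  end.

Lemma cutoff_le1 u : cutoff u <= 1.
Proof. by case: u => [r||]//=; rewrite ge_min lexx. Qed.

Lemma cutoff_ge0 u : 0 <= cutoff u.
Proof. by case: u => [r||]//=; rewrite le_min ler01 le_max lexx. Qed.

Lemma cutoff_bounded u : `|cutoff u| <= 1.
Proof. by rewrite ger0_norm ?cutoff_ge0 ?cutoff_le1. Qed.

Lemma cutoff_le_indic u : cutoff u <= \1_[set v : \bar R | (1%:E < v)%E] u.
Proof.
rewrite indicE; case: (boolP (u \in _)) => [_|]; first exact: cutoff_le1.
rewrite notin_setE; case: u => [r||]//=; last by rewrite ltry.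
move/negP; rewrite lte_fin -leNgt => r1.
by rewrite ge_min (max_idPl _) ?lexx ?orbT// subr_le0.
Qed.

Lemma cutoff_eq1 u : (2%:E <= u)%E -> cutoff u = 1.
Proof.
case: u => [r||]//=; rewrite lee_fin => r2.
by rewrite (min_idPl _)// le_max lerBrDl r2 orbT.
Qed.

Lemma continuous_cutoff : continuous cutoff.
Proof.
have cr : continuous (fun r : R => Num.min 1 (Num.max 0 (r - 1))).
  rewrite -[X in continuous X]/(cst 1 \min (cst 0 \max (fun r : R => r - 1))).
  apply: min_fun_continuous; first exact: cst_continuous.
  apply: max_fun_continuous; first exact: cst_continuous.
  by move=> r; apply: cvgB; [exact: cvg_id|exact: cvg_cst].
case=> [r||] A /= nA.
- exact: (cr r A nA).
- exists 2; split; first by rewrite num_real.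
  case=> [r||]//= r2; last exact: nbhs_singleton.
  have -> : Num.min 1 (Num.max 0 (r - 1)) = 1.
    by apply: (@cutoff_eq1 r%:E); exact: ltW.
  exact: nbhs_singleton.
- exists 0; split; first by rewrite num_real.
  case=> [r||]//= r0; last exact: nbhs_singleton.
  have -> : Num.min 1 (Num.max 0 (r - 1)) = 0.
    rewrite (max_idPl _) ?(min_idPr _)// subr_le0.
    by move: r0; rewrite lte_fin => r0; rewrite ltW// (lt_trans r0).
  exact: nbhs_singleton.
Qed.

Lemma measurable_cutoff : measurable_fun setT cutoff.
Proof.
apply/measurable_EFinP.
have -> : EFin \o cutoff = (fun u => mine 1 (maxe 0 (u - 1)))%E.
  apply/funext => -[r||] /=; first by rewrite EFin_min EFin_max.
    by rewrite (max_idPr _) ?leey// (min_idPl _)// leey.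
  by rewrite (max_idPl _) ?leNye// (min_idPr _)// lee01.
apply: measurable_mine => //; apply: measurable_maxe => //.
exact: emeasurable_funB.
Qed.

Lemma Cinfty_cutoff : Cinfty cutoff.
Proof.
split; first exact/continuous_subspaceT/continuous_cutoff.
apply: cvg_near_cst; near=> r.
have -> : cutoff r%:E = 0.
  rewrite /= (max_idPl _) ?(min_idPr _)// subr_le0.
  by near: r; apply: nbhs_right_ltW.
by [].
Unshelve. all: by end_near. Qed.

End cutoff.

(** * Geometric lower bound for survival *)

Section survival_lower_bound.
Context {R : realType} {d d1 : measure_display} {T : measurableType d}
  {T1 : measurableType d1}.
Variables (X0 : process R T) (X : process R T1).
Hypothesis hX0 : standard_process X0 Epos.
Hypothesis hirr : forall x y, Epos x -> Epos y ->
  (0 < law X0 x [set w | (tau_pt (traj X0 w) y < +oo)%E])%E.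
Hypothesis hFeller : feller_on_I X.
Hypothesis hext : extends_to X0 X.
Hypothesis hSF : forall (f : \bar R -> R) (t : R), Bb f -> 0 < t ->
  {within Epos, continuous (semigroup X t f)} /\
  exists C : R, forall x, Epos x -> `|semigroup X t f x| <= C.

Let hX : standard_process X Iext. Proof. by case: hFeller. Qed.

(** [extends_to] compares positions of the two processes only at fixed times, so a hitting
    probability of [X0] must first become a positive probability at a fixed time. *)
Lemma irreducible_nbhs x (y : R) (U : set (\bar R)) : Epos x -> 0 < y ->
  measurable U -> U `<=` Iext -> nbhs (y%:E) U ->
  exists2 s, 0 < s & (0 < law X x (pos X s @^-1` U))%E.
Proof.
move=> xE y0 mU UI nU.
have yE : Epos y%:E by rewrite /Epos /= lte_fin y0 ltry.
have [s s0 sU] := reaches_nbhs hX0 (or_introl xE) mU nU (hirr xE yE).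
by exists s => //; rewrite hext.1// ltW.
Qed.

Lemma continuous_semigroup_pos (f : \bar R -> R) (t r : R) : Bb f -> 0 < t ->
  0 < r -> {for r, continuous (fun u : R => semigroup X t f u%:E)}.
Proof.
move=> fB t0 r0; have [+ _] := hSF fB t0.
have oE : open (@Epos R).
  have -> : @Epos R = [set u | (0 < u)%E] `&` [set u | (u < +oo)%E].
    by apply/seteqP; split => u => [/andP[]|[a b]]; last exact/andP.
  by apply: openI; [exact: open_ereal_gt_ereal|exact: open_ereal_lt_ereal].
rewrite continuous_open_subspace// => /(_ r%:E).
by rewrite inE /Epos /= lte_fin r0 ltry; apply.
Qed.

Let above2 : set (\bar R) := [set u | (2%:E < u)%E].
Let above1 : set (\bar R) := [set u | (1%:E < u)%E].

Let measurable_above (a : R) : measurable [set u : \bar R | (a%:E < u)%E].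
Proof. by rewrite -set_itvoy; exact: emeasurable_itv. Qed.

Let above2I : above2 `<=` Iext.
Proof. by move=> u; apply: lt_trans; rewrite lte_fin. Qed.

Let Bb_above2 : Bb (\1_above2 : \bar R -> R).
Proof.
apply: (@Bb_bounded _ _ 1) => [|u _]; last exact: indic_bounded.
by apply: measurable_indic_Iext; exact: measurable_above.
Qed.

(** Near each starting point the strong Feller property keeps one time and one positive bound valid;
    compactness of [1, 2] makes the bound uniform, though not the time. *)
Lemma uniformly_reaches_above2 : exists2 e : R, 0 < e <= 1 &
  forall r : R, 1 <= r <= 2 ->
    exists2 s, 0 < s & e <= semigroup X s \1_above2 r%:E.
Proof.
pose P (e r : R) := exists2 s, 0 < s & e <= semigroup X s \1_above2 r%:E.
have : \forall e \near 0^'+, `[1 : R, 2]%classic `<=` P e.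
  apply: (iffLR (compact_near_coveringP _)) => [|r]; first exact: segment_compact.
  rewrite /= in_itv/= => /andP[r1 r2]; have r0 : 0 < r by exact: lt_le_trans r1.
  have rE : Epos r%:E by rewrite /Epos /= lte_fin r0 ltry.
  have n3 : nbhs ((3 : R)%:E) above2.
    apply: open_nbhs_nbhs; split; first exact: open_ereal_gt_ereal.
    by rewrite /above2/= lte_fin ltr_nat.
  have [//|s s0 sU] := irreducible_nbhs rE _ (measurable_above 2) above2I n3.
  have a0 : 0 < semigroup X s \1_above2 r%:E.
    rewrite (semigroup_indic hX _ (ltW s0) (measurable_above 2)).
    rewrite (setIidl above2I) fine_gt0// sU/=.
    rewrite (le_lt_trans (probability_le1 _ _)) ?ltry//.
    exact: (measurable_pos_preimage hX (ltW s0) (measurable_above 2)).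
  have cs := continuous_semigroup_pos Bb_above2 s0 r0.
  (* Half of the positive value at [r] remains a lower bound near [r]. *)
  pose a := semigroup X s \1_above2 r%:E / 2.
  have aa : a < semigroup X s \1_above2 r%:E by rewrite /a; lra.
  have a20 : 0 < a by exact: divr_gt0.
  exists ([set r' : R | a < semigroup X s \1_above2 r'%:E], [set e | e <= a]).
    by split; [exact: (cvgr_gt _ cs _ aa)|exact: nbhs_right_ltW].
  by move=> [r' e] [/= ar' ea]; exists s => //; exact/ltW/(le_lt_trans ea).
move=> H; have : \forall e \near 0^'+, [/\ 0 < e, e <= 1 & `[1 : R, 2]%classic `<=` P e].
  near=> e; split.
  - by near: e; exact: nbhs_right_gt.
  - by near: e; exact: nbhs_right_ltW.
  - by near: e.
move=> /filter_ex[e [e0 e1 eP]]; exists e; first by rewrite e0 e1.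
by move=> r r12; apply: eP; rewrite /= in_itv.
Unshelve. all: by end_near. Qed.

(** For small [t], [p_t cutoff] is uniformly within 1/2 of [cutoff], which is 1 on [2, oo] and lies
    below the indicator of [above1]. *)
Lemma small_time_above1 : exists2 t0 : R, 0 < t0 &
  forall x, (2%:E <= x)%E -> 2^-1 <= semigroup X t0 \1_above1 x.
Proof.
have [_ _ fc] := hFeller; have := fc _ (Cinfty_cutoff R).
move=> /(_ [set u | (u < (2^-1)%:E)%E]) H.
have {}H : \forall t \near 0^'+,
    (sup_norm (fun x => (semigroup X t (@cutoff R) x - cutoff x)%R) < (2^-1)%:E)%E.
  apply: H; apply: open_nbhs_nbhs; split; first exact: open_ereal_lt_ereal.
  by rewrite /= lte_fin invr_gt0 ltr0n.
have : \forall t \near 0^'+, 0 < t /\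
    (sup_norm (fun x => (semigroup X t (@cutoff R) x - cutoff x)%R) < (2^-1)%:E)%E.
  by near=> t; split; near: t => //; exact: nbhs_right_gt.
move=> /filter_ex[t [t0 /ltW/sup_norm_leP tc]]; exists t => // x x2.
have xI : Iext x by apply: lt_le_trans x2; rewrite lte_fin.
have := tc x xI; rewrite cutoff_eq1// ler_norml => /andP[+ _].
rewrite lerBrDl => h; apply: (@le_trans _ _ (semigroup X t (@cutoff R) x)).
  by apply: le_trans h; lra.
apply: (semigroup_le hX x (ltW t0) (Cf := 1) (Cg := 1)).
- by apply: measurable_funTS; exact: measurable_cutoff.
- by apply: measurable_indic_Iext; exact: measurable_above.
- by move=> u _; exact: cutoff_bounded.
- by move=> u _; exact: indic_bounded.
- by move=> u _; exact: cutoff_le_indic.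
Unshelve. all: by end_near. Qed.

(* From [2, oo] the process is above 1 at time [t0] with probability 1/2, and
   from (1, 2] it returns above 2 at some time with probability at least [e]; that
   time may depend on the starting point because survival decreases in time. *)
Lemma survival_geometric_lower_bound : exists t0 k : R, [/\ 0 < t0, 0 < k &
  forall n x, (2%:E <= x)%E -> k ^+ n <= survival X (n%:R * t0) x].
Proof.
have [e /andP[e0 e1] eP] := uniformly_reaches_above2.
have [t0 t00 tP] := small_time_above1.
(* Each step costs 1/2 for being above 1 at time [t0] and [e] for climbing back above 2. *)
exists t0, (e / 2); split => //; first by rewrite divr_gt0.
have e20 : 0 <= e / 2 by rewrite divr_ge0// ltW.
have e21 : e / 2 <= 1 by lra.
elim=> [x x2|n IHn x x2].
  have xI : Iext x by apply: lt_le_trans x2; rewrite lte_fin.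
  rewrite expr0 mul0r -lee_fin (survivalE hX)//.
  have <- := law_start hX (or_introl xI : augmented Iext x).
  apply: le_measure; rewrite ?inE.
  - by apply: (measurable_pos_preimage hX (B := [set x])).
  - by apply: (measurable_pos_preimage hX) => //; exact: measurable_Iext.
  by move=> w /= ->.
have nt0 : 0 <= n%:R * t0 by rewrite mulr_ge0// ltW.
have xI : Iext x by apply: lt_le_trans x2; rewrite lte_fin.
have kn : 0 <= (e / 2) ^+ n by exact: exprn_ge0.
have en0 : 0 <= e * (e / 2) ^+ n by apply: mulr_ge0 => //; exact: ltW.
have surv_bound s u : 0 <= s -> Iext u -> `|survival X s u| <= 1.
  by move=> s0 _; rewrite ger0_norm ?survival_ge0// (survival_le1 hX).
(* The induction hypothesis passes from [2, oo] to (1, oo] at the price of a factor [e]. *)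
have above1_bound u : above1 u -> e * (e / 2) ^+ n <= survival X (n%:R * t0) u.
  move=> u1; have [u2|] := leP 2%:E u.
    by apply: le_trans (IHn u u2); rewrite ler_piMl.
  move: u u1 => [r||]//; rewrite /above1/= !lte_fin => r1 r2.
  have [|s s0 es] := eP r; first by rewrite !ltW.
  apply: (@le_trans _ _ (survival X (s + n%:R * t0) r%:E)); last first.
    by apply: (survival_decr hX) => //; rewrite lerDr ltW.
  have rI : Iext r%:E by rewrite /Iext/= lte_fin (lt_trans _ r1).
  rewrite -(semigroup_survival hX (ltW s0) nt0 rI).
  rewrite mulrC; apply: (@le_trans _ _ ((e / 2) ^+ n * semigroup X s \1_above2 r%:E)).
    exact: ler_wpM2l.
  rewrite -semigroupZ; apply: (semigroup_le hX _ (ltW s0) (Cf := 1) (Cg := 1)).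
  - by apply: measurable_funM => //; apply: measurable_indic_Iext; exact: measurable_above.
  - exact: (measurable_survival hX).
  - move=> u _; rewrite normrM ger0_norm// mulr_ile1 ?indic_bounded//.
    exact: exprn_ile1.
  - by move=> u uI; exact: surv_bound.
  - move=> u uI; rewrite indicE; case: (boolP (u \in _)) => [|_]; last first.
      by rewrite mulr0 (survival_ge0 _ _ _).
    by rewrite mulr1 inE /above2/= => /ltW/IHn.
rewrite -[in leRHS]natr1 mulrDl mul1r addrC -(semigroup_survival hX (ltW t00) nt0 xI).
apply: (@le_trans _ _ (e * (e / 2) ^+ n * semigroup X t0 \1_above1 x)).
  have -> : (e / 2) ^+ n.+1 = e * (e / 2) ^+ n * 2^-1 by rewrite exprS; lra.
  by rewrite ler_wpM2l ?tP// mulr_ge0// ltW.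
rewrite -semigroupZ; apply: (semigroup_le hX _ (ltW t00) (Cf := 1) (Cg := 1)).
- by apply: measurable_funM => //; apply: measurable_indic_Iext; exact: measurable_above.
- exact: (measurable_survival hX).
- move=> u _; rewrite normrM (ger0_norm en0).
  apply: mulr_ile1 => //; last exact: indic_bounded.
  by apply: mulr_ile1 => //; [exact: ltW|exact: exprn_ile1].
- by move=> u uI; exact: surv_bound.
- move=> u uI; rewrite indicE; case: (boolP (u \in _)) => [|_]; last first.
    by rewrite mulr0 (survival_ge0 _ _ _).
  by rewrite mulr1 inE => /above1_bound.
Qed.

End survival_lower_bound.

Lemma nat_upper_bound (R : realType) (x : R) : exists n : nat, x <= n%:R.
Proof.
exists (Num.bound `|x|); apply: (le_trans (ler_norm x)).
exact/ltW/archi_boundP.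
Qed.

(** * Survival bounds and the set defining the decay rate *)

Section decay_rate_facts.
Context {R : realType} {d : measure_display} {T : measurableType d}.
Variables (X : process R T).
Hypothesis hX : standard_process X Iext.
Hypothesis htau : forall x, Iext x ->
  {ae law X x, forall w, lifetime (traj X w) = tau0 (traj X w)}.

Let decay_set : set R := [set lam : R | 0 <= lam /\ forall x, Iext x ->
    (\int[law X x]_w expeR (lam%:E * tau0 (traj X w)) < +oo)%E].

Let mIext t : 0 <= t -> measurable (pos X t @^-1` Iext).
Proof.
by move=> t0; apply: (measurable_pos_preimage hX) => //; exact: measurable_Iext.
Qed.

Let lifetime_gt t w : 0 <= t -> (t%:E < lifetime (traj X w))%E ->
  Iext (pos X t w).
Proof.
move=> t0; rewrite ltNge => /negP tw; have [//|Xt] := pos_augmented hX w t0.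
by exfalso; apply: tw; apply: ereal_inf_lbound; exists t.
Qed.

Let lifetime_ge0 w : (0 <= lifetime (traj X w))%E.
Proof. by apply: le_ereal_inf_tmp => _ [s [s0 _] <-]; rewrite lee_fin. Qed.

(** Markov's inequality for [exp (lam * tau0)]: almost surely [tau0] is the lifetime, which is at
    least [t] when the path is alive at [t]. *)
Lemma survival_exponential_bound lam x : decay_set lam -> Iext x ->
  exists C : R, forall t, 0 <= t -> survival X t x <= C * expR (- (lam * t)).
Proof.
move=> [lam0 fin] xI; have := fin x xI; set J := (\int[_]_w _)%E => Joo.
have J0 : (0 <= J)%E by apply: integral_ge0 => w _; exact: expeR_ge0.
exists (fine J) => t t0; rewrite expRN ler_pdivlMr ?expR_gt0//.
rewrite -lee_fin fineK; last by rewrite ge0_fin_numE.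
rewrite mulrC EFinM (survivalE hX)// -[pos X t @^-1` _]setIT.
rewrite -integral_indic//; last exact: mIext.
rewrite -ge0_integralZl_EFin ?expR_ge0//; last first.
  by apply/measurable_EFinP; apply: measurable_indic; exact: mIext.
have [N [mN N0 NP]] := htau xI.
apply: (ge0_le_integral_negligible mN N0) => [w|w|w Nw].
- by rewrite -EFinM lee_fin mulr_ge0// ?expR_ge0// indicE.
- exact: expeR_ge0.
have -> : tau0 (traj X w) = lifetime (traj X w).
  by apply/esym; apply: contrapT => h; apply: Nw; apply: NP.
rewrite -EFinM indicE; case: (boolP (w \in _)) => [|_]; last first.
  by rewrite mulr0 expeR_ge0.
rewrite inE mulr1 => wI.
have tw : (t%:E <= lifetime (traj X w))%E.
  by apply: (lifetime_ge hX) => // Xc; move: wI; rewrite /= Xc.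
rewrite -[(_)%:E]/(expeR (lam * t)%:E) lee_expeR EFinM.
by apply: lee_wpmul2l => //; rewrite lee_fin.
Qed.

(* [exp (lam * lifetime)] is dominated by the sum of [exp (lam * n.+2)] over the
   integers [n.+1] at which the path is alive, plus [exp lam]. *)
Lemma exponential_bound_decay_set lam c M : 0 <= lam < c ->
  (forall t x, 0 < t -> Iext x -> survival X t x <= M * expR (- (c * t))) ->
  decay_set lam.
Proof.
move=> /andP[lam0 lamc] HM; split => // x xI.
pose a n w : \bar R := (expR (lam * n.+2%:R) *
  \1_(pos X n.+1%:R @^-1` Iext) w)%:E.
have a0 n w : (0 <= a n w)%E.
  by rewrite lee_fin mulr_ge0// ?expR_ge0// indicE.
have ma n : measurable_fun setT (a n).
  apply/measurable_EFinP; apply: measurable_funM => //.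
  by apply: measurable_indic; exact: mIext.
have sa0 w : (0 <= \sum_(n <oo) a n w)%E by apply: nneseries_ge0.
have [N [mN N0 NP]] := htau xI.
apply: (@le_lt_trans _ _
  (\int[law X x]_w ((expR lam)%:E + \sum_(n <oo) a n w))%E).
  apply: (ge0_le_integral_negligible mN N0) => [w|w|w Nw].
  - exact: expeR_ge0.
  - by rewrite adde_ge0// lee_fin expR_ge0.
  have -> : tau0 (traj X w) = lifetime (traj X w).
    by apply/esym; apply: contrapT => h; apply: Nw; apply: NP.
  have := @lifetime_gt ^~ w; have := lifetime_ge0 w.
  case: (lifetime _) => [r||]// r0 alive; last first.
    (* An immortal path is alive at every integer, so every term is at least 1 and the series
       diverges. *)
    suff -> : (\sum_(n <oo) a n w = +oo)%E by rewrite addey// leey.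
    apply: eq_infty => A.
    have [n An] : exists n : nat, A <= n%:R.
      exact: nat_upper_bound.
    apply: (@le_trans _ _ (\sum_(0 <= i < n) a i w)%E); last first.
      exact: nneseries_lim_ge.
    apply: (@le_trans _ _ (\sum_(0 <= i < n) 1)%E).
      by rewrite sumEFin big_const_nat iter_addr_0 subn0 lee_fin.
    apply: lee_sum => i _; rewrite lee_fin indicE mem_set; last first.
      by apply: alive => //; rewrite ltry.
    by rewrite mulr1 -expR0 ler_expR mulr_ge0.
  rewrite lee_fin in r0; rewrite -EFinM [leLHS]/=.
  have [r1|r1] := leP r 1.
    rewrite -[leLHS]adde0; apply: leeD => //.
    by rewrite lee_fin ler_expR -[leRHS]mulr1 ler_wpM2l.
  (* With [n.+2] the least integer not below [r], the path is alive at [n.+1 < r], and the term of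
     index [n] is [exp (lam * n.+2)]. *)
  have exm : exists m : nat, r <= m%:R.
    exact: nat_upper_bound.
  case: (ex_minnP exm) => -[|[|n]] rn nmin.
  - by move: r1; rewrite ltNge (le_trans rn).
  - by move: r1; rewrite ltNge rn.
  have nr : n.+1%:R < r.
    by rewrite ltNge; apply/negP => /nmin; rewrite ltnn.
  rewrite -[leLHS]add0e; apply: leeD; first by rewrite lee_fin expR_ge0.
  apply: (@le_trans _ _ (\sum_(0 <= i < n.+1) a i w)%E); last first.
    exact: nneseries_lim_ge.
  rewrite big_nat_recr//= -[leLHS]add0e; apply: leeD.
    by apply: sume_ge0.
  rewrite lee_fin indicE mem_set; last first.
    by apply: alive => //; rewrite lte_fin.
  by rewrite mulr1 ler_expR ler_wpM2l.
rewrite ge0_integralD ?expR_ge0//; last first.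
  exact: ge0_emeasurable_sum.
apply: lte_add_pinfty.
  rewrite integral_cst//; apply: (@le_lt_trans _ _ ((expR lam)%:E * 1)%E).
    by apply: lee_wpmul2l; [rewrite lee_fin expR_ge0|exact: probability_le1].
  by rewrite mule1 ltry.
rewrite integral_nneseries//.
pose q := expR (lam - c).
have q0 : 0 < q by exact: expR_gt0.
have q1 : `|q| < 1 by rewrite ger0_norm ?ltW// -expR0 ltr_expR subr_lt0.
have M0 : 0 <= M.
  have := HM 1 x ltr01 xI; rewrite -ler_pdivrMr ?expR_gt0//; apply: le_trans.
  by rewrite divr_ge0 ?survival_ge0 ?expR_ge0.
(* [exp (lam (i + 2)) * M exp (- c (i + 1))] equals [b * q ^ i], with [q < 1] because [lam < c]. *)
pose b := M * expR (lam *+ 2 - c).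
apply: (@le_lt_trans _ _ (b * (1 - q)^-1)%:E); last by rewrite ltry.
apply: lime_le.
  by apply: is_cvg_nneseries => n _ _; apply: integral_ge0.
apply: nearW => n.
apply: (@le_trans _ _ (series (geometric b q) n)%:E); last first.
  by rewrite lee_fin geometric_le_lim// mulr_ge0 ?expR_ge0.
rewrite /series/= -sumEFin; apply: lee_sum => i _.
have -> : (\int[law X x]_w a i w =
    (expR (lam * i.+2%:R) * survival X i.+1%:R x)%:E)%E.
  rewrite EFinM (survivalE hX)// -[pos X _ @^-1` _]setIT -integral_indic//; last exact: mIext.
  rewrite -ge0_integralZl_EFin ?expR_ge0//.
  by apply/measurable_EFinP; apply: measurable_indic; exact: mIext.
rewrite lee_fin; apply: (@le_trans _ _ (expR (lam * i.+2%:R) * (M * expR (- (c * i.+1%:R))))).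
  by rewrite ler_wpM2l ?expR_ge0// HM.
rewrite mulrCA -expRD /b -mulrA /q -expRM_natl -expRD ler_wpM2l// ler_expR.
rewrite -!natr1; lra.
Qed.

(** Along the times [n t0], the geometric lower bound and the exponential upper bound for survival
    conflict for large [n] once [lam] exceeds [- ln k / t0]. *)
Lemma has_ubound_decay_set x t0 k : Iext x -> 0 < t0 -> 0 < k ->
  (forall n, k ^+ n <= survival X (n%:R * t0) x) -> has_ubound decay_set.
Proof.
move=> xI t00 k0 Hk; exists (- ln k / t0) => lam lamD.
have [C HC] := survival_exponential_bound lamD xI.
rewrite ler_pdivlMr// lerNr -subr_le0 opprK.
rewrite leNgt; apply/negP => pos.
(* The bound [exp (n (ln k + lam t0)) <= C], linearised by [1 + y <= exp y]. *)
have nC n : n%:R * (ln k + lam * t0) <= C.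
  have := le_trans (Hk n) (HC (n%:R * t0) _).
  rewrite mulr_ge0 ?(ltW t00)// => /(_ isT).
  rewrite expRN ler_pdivlMr ?expR_gt0// -{1}(lnK (k0 : k \is Num.pos)).
  rewrite -expRM_natl -expRD; apply: le_trans.
  by apply: (le_trans _ (expR_ge1Dx _)); lra.
have := archi_boundP (normr_ge0 (C / (ln k + lam * t0))).
set n := Num.bound _ => Hn; have := nC n; rewrite leNgt => /negP; apply.
rewrite -ltr_pdivrMr//; exact: le_lt_trans (ler_norm _) Hn.
Qed.

End decay_rate_facts.

(** * The limit of normalized survival: an eigenfunction, continuous and positive *)

(** Lets [t] tend to infinity in the error bounds below. At the time [n + 1] with
    [n >= |M| / (a delta)], [exp (delta (n + 1))] already exceeds [|M| / a]. *)
Lemma expR_decay_le0 (R : realType) (a M delta : R) : 0 < delta ->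
  (forall t, 0 < t -> a <= M * expR (- (delta * t))) -> a <= 0.
Proof.
move=> delta0 H; rewrite leNgt; apply/negP => a0.
have [n nM] := nat_upper_bound (`|M| / a / delta).
have n0 : 0 < n.+1%:R :> R by rewrite ltr0n.
have := H _ n0; rewrite expRN ler_pdivlMr ?expR_gt0// leNgt => /negP; apply.
apply: (le_lt_trans (ler_norm M)).
move: nM; rewrite ler_pdivrMr// => nM.
rewrite -ltr_pdivrMl// [ltLHS]mulrC.
apply: (le_lt_trans nM); apply: lt_le_trans (expR_ge1Dx _).
by rewrite -natr1 mulrDr mulr1 [n%:R * _]mulrC; lra.
Qed.

Section limit_of_normalized_survival.
Context {R : realType} {d d1 : measure_display} {T : measurableType d}
  {T1 : measurableType d1}.
Variables (X0 : process R T) (X : process R T1).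
Hypothesis hX0 : standard_process X0 Epos.
Hypothesis hirr : forall x y, Epos x -> Epos y ->
  (0 < law X0 x [set w | (tau_pt (traj X0 w) y < +oo)%E])%E.
Hypothesis hFeller : feller_on_I X.
Hypothesis hext : extends_to X0 X.
Hypothesis hSF : forall (f : \bar R -> R) (t : R), Bb f -> 0 < t ->
  {within Epos, continuous (semigroup X t f)} /\
  exists C : R, forall x, Epos x -> `|semigroup X t f x| <= C.
Variables (lam0 delta M : R) (h : \bar R -> R).
Hypothesis delta0 : 0 < delta.
Hypothesis hsurv : forall t x, 0 < t -> Iext x ->
  `|expR (lam0 * t) * survival X t x - h x| <= M * expR (- (delta * t)).

Let hX : standard_process X Iext. Proof. by case: hFeller. Qed.

Let Iext_oo : Iext (+oo%E : \bar R). Proof. by rewrite /Iext/= ltry. Qed.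

Let Epos_Iext : @Epos R `<=` Iext. Proof. by move=> u /andP[]. Qed.

Let M0 : 0 <= M.
Proof.
have := hsurv ltr01 Iext_oo; rewrite -ler_pdivrMr ?expR_gt0//.
by apply: le_trans; rewrite divr_ge0// expR_ge0.
Qed.

Lemma limit_ge0 x : Iext x -> 0 <= h x.
Proof.
move=> xI; rewrite -oppr_le0; apply: (expR_decay_le0 delta0 (M := M)) => t t0.
apply: le_trans (hsurv t0 xI); rewrite ler_normr; apply/orP; left.
by rewrite lerDr mulr_ge0 ?expR_ge0 ?survival_ge0.
Qed.

(** Time 1 supplies both terms: survival is at most 1 and the error at most [M]. *)
Lemma limit_bounded x : Iext x -> `|h x| <= M + expR lam0.
Proof.
move=> xI; have := hsurv ltr01 xI; rewrite !mulr1 => H.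
have s1 : `|expR lam0 * survival X 1 x| <= expR lam0.
  rewrite ger0_norm ?mulr_ge0 ?expR_ge0 ?survival_ge0//.
  by rewrite -[leRHS]mulr1 ler_wpM2l ?expR_ge0// (survival_le1 hX).
have -> : h x = expR lam0 * survival X 1 x -
    (expR lam0 * survival X 1 x - h x) by lra.
apply: (le_trans (ler_normB _ _)); rewrite addrC lerD//.
apply: (le_trans H); rewrite -[leRHS]mulr1 ler_wpM2l// -expR0 ler_expR.
by rewrite oppr_le0 ltW.
Qed.

(** [h] is the pointwise limit of normalized survival at the times [n.+1], the shift keeping them
    positive. *)
Lemma measurable_limit : measurable_fun Iext h.
Proof.
apply: (@measurable_fun_cvg _ _ _ Iext
  (fun n x => expR (lam0 * n.+1%:R) * survival X n.+1%:R x)) => [n|x xI].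
  by apply: measurable_funM => //; exact: (measurable_survival hX).
apply/cvgrPdist_le => e e0.
have q1 : `|expR (- delta)| < 1.
  by rewrite ger0_norm ?expR_ge0// -expR0 ltr_expR oppr_lt0.
have := @cvg_geometric R M (expR (- delta)) q1.
move=> /cvgrPdist_le/(_ e e0); apply: filterS => n /=.
rewrite sub0r normrN => Hn; rewrite distrC.
apply: (le_trans (hsurv _ xI)) => //; apply: (le_trans _ Hn).
rewrite ger0_norm ?mulr_ge0 ?exprn_ge0 ?expR_ge0// ler_wpM2l//.
rewrite -expRM_natl ler_expR. rewrite -natr1.
by rewrite mulrDr mulr1 mulrN mulrC opprD gerDl oppr_le0 ltW.
Qed.

Lemma Bb_limit : Bb h.
Proof. by apply: Bb_bounded limit_bounded; exact: measurable_limit. Qed.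

(** The difference of the two sides is the error at time [s + t] minus [exp (lam0 s) p_s] of the
    error at time [t]; both vanish as [t] grows. *)
Lemma limit_eigenfunction s x : 0 < s -> Iext x ->
  expR (lam0 * s) * semigroup X s h x = h x.
Proof.
move=> s0 xI; apply/eqP; rewrite -subr_eq0 -normr_le0.
apply: (expR_decay_le0 delta0 (M := M * (1 + expR (lam0 * s)))) => t t0.
have -> : expR (lam0 * s) * semigroup X s h x - h x =
  (expR (lam0 * (s + t)) * survival X (s + t) x - h x) -
  expR (lam0 * s) * semigroup X s
    (fun u => expR (lam0 * t) * survival X t u - h u) x.
  rewrite (semigroupB hX x (ltW s0) (Cf := expR (lam0 * t)) (Cg := M + expR lam0)).
  - rewrite semigroupZ (semigroup_survival hX (ltW s0) (ltW t0) xI).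
    by rewrite mulrDr expRD; lra.
  - by apply: measurable_funM => //; exact: (measurable_survival hX (ltW t0)).
  - exact: measurable_limit.
  - move=> u _; rewrite ger0_norm ?mulr_ge0 ?expR_ge0 ?survival_ge0//.
    by rewrite -[leRHS]mulr1 ler_wpM2l ?expR_ge0// (survival_le1 hX _ (ltW t0)).
  - by move=> u; exact: limit_bounded.
apply: (le_trans (ler_normB _ _)).
rewrite [leRHS](_ : _ = M * expR (- (delta * t)) +
  expR (lam0 * s) * (M * expR (- (delta * t)))); last by ring.
apply: lerD.
  apply: (le_trans (hsurv (addr_gt0 s0 t0) xI)).
  by rewrite ler_wpM2l// ler_expR lerN2 ler_pM2l// lerDr ltW.
rewrite normrM ger0_norm ?expR_ge0//; apply: ler_wpM2l; first exact: expR_ge0.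
apply: (semigroup_norm hX x (ltW s0)).
  apply: measurable_funB; last exact: measurable_limit.
  by apply: measurable_funM => //; exact: (measurable_survival hX (ltW t0)).
by move=> u uI; exact: hsurv.
Qed.

(** By the eigenfunction identity at time 1, [h] inherits the strong Feller continuity of
    [p_1 h]. *)
Lemma continuous_limit r : 0 < r -> {for r, continuous (fun u : R => h u%:E)}.
Proof.
move=> r0; have c1 := continuous_semigroup_pos hSF Bb_limit ltr01 r0.
have c2 : (fun u : R => expR lam0 * semigroup X 1 h u%:E) @ r -->
    expR lam0 * semigroup X 1 h r%:E.
  by apply: cvgM; [exact: cvg_cst|exact: c1].
have eE u : 0 < u -> expR lam0 * semigroup X 1 h u%:E = h u%:E.
  by move=> u0; rewrite -{1}(mulr1 lam0) limit_eigenfunction// /Iext/= lte_fin.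
rewrite (eE r r0) in c2; apply: cvg_trans c2.
apply: near_eq_cvg; near=> u; rewrite /= eE//.
near: u; exact: lt_nbhsr.
Unshelve. all: by end_near. Qed.

(** If [h y > 0], then [h] exceeds [h y / 2] near [y], a region occupied at some fixed time with
    positive probability from [x]; the eigenfunction identity then gives [h x > 0]. *)
Lemma limit_zero_spreads x y : Epos x -> h x = 0 -> Epos y -> h y = 0.
Proof.
move=> xE hx0; case: y => [y||]//= yE; last by move: yE; rewrite /Epos/= ltxx andbF.
have y0 : 0 < y by move: yE; rewrite /Epos/= lte_fin => /andP[].
apply/eqP/negPn/negP => hyn0.
have hy0 : 0 < h y%:E by rewrite lt_neqAle eq_sym hyn0 limit_ge0// ; exact: Epos_Iext.
pose a := h y%:E / 2; have a0 : 0 < a by exact: divr_gt0.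
pose U := Iext `&` [set u | a < h u].
have mU : measurable U.
  rewrite (_ : U = Iext `&` h @^-1` `]a, +oo[%classic).
    by apply: measurable_limit => //; exact: measurable_Iext.
  by apply/seteqP; split => u [uI /= au]; split => //=; move: au; rewrite in_itv/= andbT.
have nU : nbhs (y%:E) U.
  rewrite /nbhs/=; near=> r; split.
    by rewrite /Iext/= lte_fin; near: r; exact: lt_nbhsr.
  rewrite /=; near: r; apply: (cvgr_gt _ (continuous_limit y0)).
  by rewrite /a; lra.
have [//|s s0 sU] := irreducible_nbhs hX0 hirr hext xE y0 mU _ nU.
  by move=> u [].
have : a * semigroup X s \1_U x <= semigroup X s h x.
  rewrite -semigroupZ; apply: (semigroup_le hX x (ltW s0) (Cf := a) (Cg := M + expR lam0)).
  - by apply: measurable_funM => //; exact: measurable_indic_Iext.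
  - exact: measurable_limit.
  - move=> u _; rewrite normrM (ger0_norm (ltW a0)) -[leRHS]mulr1.
    by apply: ler_wpM2l; [exact: ltW|exact: indic_bounded].
  - by move=> u; exact: limit_bounded.
  move=> u uI; rewrite indicE; case: (boolP (u \in _)) => [|_].
    by rewrite inE mulr1 => -[_ /ltW].
  by rewrite mulr0 limit_ge0.
have := limit_eigenfunction s0 (Epos_Iext xE); rewrite hx0 => /eqP.
rewrite mulf_eq0 gt_eqF ?expR_gt0//= => /eqP ->.
rewrite leNgt mulr_gt0// (semigroup_indic hX _ (ltW s0) mU).
rewrite setIidl; last by move=> u [].
rewrite fine_gt0// sU/= (le_lt_trans (probability_le1 _ _)) ?ltry//.
exact: (measurable_pos_preimage hX (ltW s0) mU).
Unshelve. all: by end_near. Qed.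

Lemma limit_gt0 x : 0 < h +oo%E -> Iext x -> 0 < h x.
Proof.
move=> hoo xI; rewrite lt_neqAle limit_ge0// andbT; apply/eqP => /esym hx0.
have xE : Epos x.
  rewrite /Epos/= xI/= ltey; apply/eqP => xoo.
  by move: hx0; rewrite xoo => /eqP; rewrite gt_eqF.
have hE0 y : Epos y -> h y = 0 by exact: limit_zero_spreads hx0.
(* Two bounds on [p_t cutoff] at [+oo] will give [1 <= M exp (- delta t)] for all [t > 0]. *)
suff : 1 <= 0 :> R by rewrite ler10.
apply: (expR_decay_le0 delta0 (M := M)) => t t0.
have oI : open (@Iext R) by exact: open_ereal_gt_ereal.
pose g := semigroup X t (@cutoff R).
have gE r : Epos r%:E -> g r%:E <= expR (- (lam0 * t)) * (M * expR (- (delta * t))).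
  move=> rE; apply: (@le_trans _ _ (survival X t r%:E)).
    rewrite -(semigroup1 hX _ (ltW t0)).
    apply: (semigroup_le hX _ (ltW t0) (Cf := 1) (Cg := 1)).
    - by apply: measurable_funTS; exact: measurable_cutoff.
    - by apply: measurable_indic_Iext; exact: measurable_Iext.
    - by move=> u _; exact: cutoff_bounded.
    - by move=> u _; exact: indic_bounded.
    - by move=> u uI; rewrite indicE mem_set// cutoff_le1.
  rewrite (expRN (lam0 * t)) ler_pdivlMl ?expR_gt0//.
  have := hsurv t0 (Epos_Iext rE); rewrite hE0// subr0.
  by apply: le_trans; exact: ler_norm.
(* Continuity of [p_t cutoff] carries the bound to [+oo]; the indicator of [Iext] would not do,
   since it has no limit 0 at 0. *)
have goo : g +oo%E <= expR (- (lam0 * t)) * (M * expR (- (delta * t))).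
  rewrite leNgt; apply/negP => gb.
  have [_ fc _] := hFeller.
  have [+ _] := fc t _ (ltW t0) (Cinfty_cutoff R).
  rewrite continuous_open_subspace// => /(_ +oo%E); rewrite inE => /(_ Iext_oo) cg.
  have [A [_ HA]] := cvgr_gt _ cg _ gb.
  have Am : A < Num.max A 0 + 1 by rewrite ltr_pwDr// le_max lexx.
  have mE : Epos (Num.max A 0 + 1)%:E.
    by rewrite /Epos/= lte_fin ltry andbT ltr_wpDl// le_max lexx orbT.
  have := HA (Num.max A 0 + 1)%:E; rewrite lte_fin => /(_ Am).
  by rewrite ltNge gE.
have : expR (- (lam0 * t)) <= g +oo%E.
  have eig := limit_eigenfunction t0 Iext_oo.
  (* [h] vanishes off [+oo] and [cutoff] is 1 there, so [h <= h +oo * cutoff] on [Iext]. *)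
  have : semigroup X t h +oo%E <= h +oo%E * g +oo%E.
    rewrite -semigroupZ; apply: (semigroup_le hX _ (ltW t0)
      (Cf := M + expR lam0) (Cg := h +oo%E)).
    - exact: measurable_limit.
    - by apply: measurable_funM => //; apply: measurable_funTS; exact: measurable_cutoff.
    - by move=> u; exact: limit_bounded.
    - move=> u _; rewrite normrM (ger0_norm (ltW hoo)) -[leRHS]mulr1.
      by apply: ler_wpM2l; [exact: ltW|exact: cutoff_bounded].
    - move=> u uI; have [->|uoo] := eqVneq u +oo%E; first by rewrite /cutoff mulr1.
      rewrite hE0; first by rewrite mulr_ge0 ?cutoff_ge0// ltW.
      by rewrite /Epos/= uI ltey.
  move=> hg; rewrite -(ler_pM2l hoo); apply: le_trans hg.
  by rewrite -[in leLHS]eig mulrAC expRN mulfV ?mul1r// gt_eqF// expR_gt0.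
move=> /le_trans/(_ goo).
by rewrite -{1}[expR (- (lam0 * t))]mulr1 ler_pM2l ?expR_gt0.
Qed.

End limit_of_normalized_survival.

(** * Positivity of [Z] and the bound for the conditioned process *)

Lemma Zreal_infty (R : realType) (m : {measure set (univ_state R) -> \bar R})
    (n : \bar R -> {measure set (path_space R) -> \bar R}) (q : R) :
  Zreal m n q +oo%E = 1.
Proof.
have e0 : [set u : \bar R | (+oo < u < +oo)%E] = set0.
  by apply/seteqP; split => // u /= /andP[]; rewrite ltNge leey.
by rewrite /Zreal /Zq e0 !Rintegral_set0 /= !mulr0 subr0 addr0.
Qed.

Lemma decay_rate_ge0 (R : realType) d (T : measurableType d)
  (X : process R T) : 0 <= decay_rate X.
Proof.
rewrite /decay_rate; set D := [set lam | _].
(* A set without supremum has the default value 0. *)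
have [[[lam lamD] ubD]|noD] := pselect (has_sup D); last by rewrite sup_out.
apply: (@le_trans _ _ lam); first by case: lamD.
exact: ub_le_sup.
Qed.

Theorem theorem5p6 (R : realType)
  (d : measure_display) (T : measurableType d) (X0 : process R T)
  (m : {measure set (univ_state R) -> \bar R})
  (L : \bar R -> R -> T -> R)
  (n : \bar R -> {measure set (path_space R) -> \bar R})
  (d1 : measure_display) (T1 : measurableType d1) (X : process R T1)
  (hX0 : standard_process X0 Epos)
  (hjumps : no_negative_jumps X0)
  (hA1 : assumption_A1 X0)
  (hA2 : assumption_A2 X0)
  (hA3 : assumption_A3 X0 m)
  (hL : local_times X0 m L)
  (hn : forall y, Epos y -> excursion_measure X0 y (L y) (n y))
  (hentrance : forall t : R, 0 < t ->
     exists2 l : R -> \bar R,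
       (forall b : R, 0 < b ->
          law X0 x%:E [set w | (tau_minus (traj X0 w) b%:E <= t%:E)%E]
            @[x --> +oo%R] --> l b) &
       l b @[b --> +oo%R] --> 1%E)
  (hzeta : forall x, Epos x ->
     {ae law X0 x, forall w, lifetime (traj X0 w) = tau0 (traj X0 w)})
  (hzero : forall x, Epos x ->
     (0 < law X0 x [set w | (tau0 (traj X0 w) < +oo)%E])%E)
  (hirr : forall x y, Epos x -> Epos y ->
     (0 < law X0 x [set w | (tau_pt (traj X0 w) y < +oo)%E])%E)
  (hFeller : feller_on_I X)
  (hext : extends_to X0 X)
  (hSF : forall (f : \bar R -> R) (t : R), Bb f -> 0 < t ->
     {within Epos, continuous (semigroup X t f)} /\
     exists C : R, forall x, Epos x -> `|semigroup X t f x| <= C)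
  (lam0 : R) (hlam0 : lam0 = decay_rate X)
  (delta M : R)
  (hdelta0 : 0 < delta)
  (hdelta1 : (delta%:E < lambda1 m n lam0 - lam0%:E)%E)
  (hM0 : 0 < M)
  (hM : forall t : R, 0 < t ->
     (ereal_sup [set sup_norm (fun x => expR (lam0 * t) * semigroup X t f x
                                        - pi_op m n lam0 f x)%R
                | f in [set f | Bb f /\ (sup_norm f <= 1)%E]]
      <= (M * expR (- (delta * t)))%:E)%E) :
  forall x (t : R), Iext x -> 0 < t ->
    (ereal_sup [set (`|h_semigroup m n X lam0 t f x - mu_int m n lam0 f|)%:E
               | f in [set f : \bar R -> R | measurable_fun Iext f /\
                   (sup_norm (fun u => f u * Zreal m n (- lam0) u)%R <= 1)%E]]
     <= (M / Zreal m n (- lam0) x * expR (- (delta * t)))%:E)%E.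
Proof.
have hX : standard_process X Iext by case: hFeller.
set Z := Zreal m n (- lam0).
pose one : \bar R -> R := \1_Iext.
pose k := (rho m n lam0 * lam0)^-1.
pose c := k * nu_int m n lam0 one.
have hMf f (C : R) t x : 0 < t -> Iext x -> Bb f -> (forall u, Iext u -> `|f u| <= 1) ->
    `|expR (lam0 * t) * semigroup X t f x - pi_op m n lam0 f x| <=
    M * expR (- (delta * t)).
  move=> t0 xI fB /sup_norm_leP f1; move: x xI; apply/sup_norm_leP.
  apply: le_trans (hM t t0); apply: ereal_sup_ubound; exists f => //.
have mI := @measurable_Iext R.
(* [h] is [pi_op] at the function 1; being a multiple of [Z], it carries the sign and measurability
   over to [Z]. *)
pose h x := c * Z x.
have hsurv t x : 0 < t -> Iext x ->
    `|expR (lam0 * t) * survival X t x - h x| <= M * expR (- (delta * t)).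
  move=> t0 xI; rewrite -(semigroup1 hX _ (ltW t0)).
  have -> : h x = pi_op m n lam0 one x.
    by rewrite /h /c /pi_op -/k -/Z mulrAC.
  apply: hMf => //; last by move=> u _; exact: indic_bounded.
  apply: (@Bb_bounded _ _ 1); first exact: measurable_indic_Iext.
  by move=> u _; exact: indic_bounded.
have Zoo : Z +oo%E = 1 by exact: Zreal_infty.
have ooI : Iext (+oo%E : \bar R) by rewrite /Iext/= ltry.
have hoo : h +oo%E = c by rewrite /h Zoo mulr1.
have c0 : 0 < c.
  rewrite lt_neqAle -[in X in _ && X]hoo (limit_ge0 hdelta0 hsurv)// andbT.
  (* With [c = 0], survival is at most [M exp (- (lam0 + delta) t)], so the intermediate rate
     [lam0 + delta / 2] would belong to the bounded set whose supremum is [lam0]. *)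
  apply/eqP => /esym c0.
  have lam0_ge0 : 0 <= lam0 by rewrite hlam0 decay_rate_ge0.
  have [t0 [kap [t00 kap0 Hkap]]] :=
    survival_geometric_lower_bound hX0 hirr hFeller hext hSF.
  have ubD := has_ubound_decay_set hX hext.2 ooI t00 kap0
    (fun j => Hkap j _ (leey _)).
  suff : lam0 + delta / 2 <= lam0 by apply/negP; rewrite -ltNge; lra.
  rewrite [leRHS]hlam0; apply: (ub_le_sup ubD).
  apply: (exponential_bound_decay_set hX hext.2 (c := lam0 + delta) (M := M)).
    by apply/andP; split; lra.
  move=> t x t_gt0 xI; have := hsurv t x t_gt0 xI.
  rewrite /h c0 mul0r subr0 => /(le_trans (ler_norm _)) le.
  by rewrite mulrDl opprD expRD (expRN (lam0 * t)) mulrCA ler_pdivlMl ?expR_gt0.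
have hgt0 x : Iext x -> 0 < h x.
  by apply: (limit_gt0 hX0 hirr hFeller hext hSF hdelta0 hsurv); rewrite hoo.
have Zgt0 x : Iext x -> 0 < Z x by move=> /hgt0; rewrite /h pmulr_rgt0.
(* As [0^-1 = 0], a nonzero [k] forces both [lam0] and [rho] to be nonzero. *)
have k0 : k != 0 by apply: contraTneq c0 => k0; rewrite /c k0 mul0r ltxx.
have lam0n0 : lam0 != 0.
  by apply: contraNneq k0 => l0; rewrite /k l0 mulr0 invr0.
have rho0 : rho m n lam0 != 0.
  by apply: contraNneq k0 => r0; rewrite /k r0 mul0r invr0.
have mZ : measurable_fun Iext Z.
  have -> : Z = (fun u => c^-1 * h u).
    by apply/funext => u; rewrite /h mulKf// gt_eqF.
  apply: measurable_funM => //; exact: (measurable_limit hFeller hdelta0 hsurv).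
move=> x t xI t0; apply: ge_ereal_sup => _ [f [mf /sup_norm_leP fZ1] <-].
pose g u := Z u * f u.
have g1 u : Iext u -> `|g u| <= 1 by move=> uI; rewrite /g mulrC fZ1.
have gB : Bb g by apply: Bb_bounded g1; exact: measurable_funM.
(* The factor [lam0] in the density of [nu] cancels against [k], leaving [1 / rho]; the constant
   moves through the integral without measurability of the density. *)
have muE : mu_int m n lam0 f = pi_op m n lam0 g x / Z x.
  rewrite /pi_op -/k -/Z mulrAC mulfK ?gt_eqF ?Zgt0// mulrC -/k.
  rewrite /nu_int mulrC -RintegralZl_nomeasurable// /mu_int.
  apply: eq_Rintegral => u _; rewrite /g /k invfM -/Z; field; exact/andP.
rewrite lee_fin muE /h_semigroup -/Z -/(g) mulrAC -mulrBl normrM.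
have Zi : 0 <= (Z x)^-1 by rewrite invr_ge0; exact/ltW/Zgt0.
rewrite (ger0_norm Zi) [leRHS]mulrAC.
by apply: ler_wpM2r => //; exact: hMf.
Qed.
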